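(* Suppose that $\mathrm{Re}(\lambda_l(A))\neq\rho$ for $l=1,\dots,n$ and that $(A,B)$ is stabilizable. Suppose further that there exists a positive integer $\hat d$ such that $$\mathrm{rank}\big([\mathcal{I}_{\mathcal{X}},\ \mathcal{I}_{\mathcal{X}\mathcal{V}}]\big)=mn+\frac{n(n+1)}{2}$$ holds for every $d\ge\hat d$, where $\mathcal{I}_{\mathcal{X}},\mathcal{I}_{\mathcal{X}\mathcal{V}}$ are the data matrices built from $d$ sampling intervals (see context). Then, for $d\ge \hat d$, the sequences $\{K^k\}_{k=1}^{+\infty}$ and $\{K_Y^k\}_{k=1}^{+\infty}$ generated by the data-driven policy iteration algorithm described in the context satisfy $$\lim_{k\to+\infty}K^k=K^*,\qquad \lim_{k\to+\infty}K^k_Y=K^*_Y .$$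
   Context: **Setting.** $A\in\mathbb{R}^{n\times n}$, $B\in\mathbb{R}^{n\times m}$, $C\in\mathbb{R}^{n\times p}$ are constant matrices; $Q\in\mathbb{R}^{n\times n}$ and $R\in\mathbb{R}^{m\times m}$ are symmetric positive definite; $\rho>0$ is a discount parameter. $\lambda_l(M)$ is the $l$-th eigenvalue of a square matrix $M$. A matrix is Hurwitz if all its eigenvalues have negative real part. $M^\dagger$ is the Moore–Penrose pseudoinverse, $\otimes$ the Kronecker product, $\mathbb{I}_n$ the $n\times n$ identity. **Target gains.** $P^*>0$ is the positive definite solution of $\rho P=PA+A^TP-PBR^{-1}B^TP+Q$, and $K^*=R^{-1}B^TP^*$. $Y^*\ge 0$ is the positive semidefinite solution of $\rho Y=YA+A^TY-YBR^{-1}B^TY$ such that $A-BK_Y^*-0.5\rho\,\mathbb{I}_n$ is Hurwitz, where $K_Y^*=R^{-1}B^TY^*$. **Data.** Fix an agent $i$ with state $dx_i(t)=[Ax_i(t)+Bu_i(t)]dt+C\,dW_i(t)$, $x_i(0)=x_{i0}$, where $W_i$ is a standard $p$-dimensional Brownian motion, $x_{i0}$ is independent of $W_i$ with finite second moment, and $u_i$ is an admissible control, i.e. an $\mathbb{R}^m$-valued process adapted to the filtration generated by $W_i$ with $\mathbb{E}\int_0^{+\infty}e^{-\rho t}|u_i(t)|^2dt<+\infty$. Put $\mathcal{X}(t)=\mathbb{E}[x_i(t)]$, $\mathcal{V}(t)=\mathbb{E}[u_i(t)]$, so that $d\mathcal{X}(t)=[A\mathcal{X}(t)+B\mathcal{V}(t)]dt$,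 $\mathcal{X}(0)=\mathbb{E}[x_{i0}]$. **Vectorizations.** For a matrix $M$, $vec(M)$ stacks its columns. For symmetric $S\in\mathbb{R}^{n\times n}$, $vecs(S)=[S_{11},2S_{12},\dots,2S_{1n},S_{22},2S_{23},\dots,2S_{n-1,n},S_{nn}]^T$. For $\zeta\in\mathbb{R}^n$, $\overline{\zeta}=[\zeta_1^2,\zeta_1\zeta_2,\dots,\zeta_1\zeta_n,\zeta_2^2,\zeta_2\zeta_3,\dots,\zeta_{n-1}\zeta_n,\zeta_n^2]^T$, and $\overline{\mathcal{X}}(t)$ denotes $\overline{\zeta}$ for $\zeta=\mathcal{X}(t)$. **Data matrices.** For sampling times $0\le s_0<s_1<s_2<\cdots$ and a positive integer $d$ (the matrices below use $s_0,\dots,s_d$), let $\varphi(s_j,s_{j+1})=e^{-\rho s_{j+1}}\overline{\mathcal{X}}(s_{j+1})^T-e^{-\rho s_j}\overline{\mathcal{X}}(s_j)^T$ and define - $\mathcal{I}\in\mathbb{R}^{d\times n(n+1)/2}$, whose $(j+1)$-th row is $\varphi(s_j,s_{j+1})$; - $\mathcal{I}_{\mathcal{X}}\in\mathbb{R}^{d\times n^2}$, whose $(j+1)$-th row is $\int_{s_j}^{s_{j+1}}e^{-\rho t}[\mathcal{X}(t)\otimes\mathcal{X}(t)]^Tdt$; - $\mathcal{I}_{\mathcal{X}\mathcal{V}}\in\mathbb{R}^{d\times nm}$, whose $(j+1)$-th row is $\int_{s_j}^{s_{j+1}}e^{-\rho t}[\mathcal{X}(t)\otimes\mathcal{V}(t)]^Tdt$,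 for $j=0,\dots,d-1$. **Data-driven policy iteration algorithm.** Choose $K^0,K_Y^0\in\mathbb{R}^{m\times n}$ such that $A-BK^0$ and $A-BK_Y^0$ are Hurwitz. For $k=1,2,\dots$ set $$\Delta^k=\big[\mathcal{I},\ -2\mathcal{I}_{\mathcal{X}}(\mathbb{I}_n\otimes(K^{k-1})^T)-2\mathcal{I}_{\mathcal{X}\mathcal{V}}\big],\quad \Theta^k=\mathcal{I}_{\mathcal{X}}\,vec\big(-(K^{k-1})^TRK^{k-1}-Q\big),$$ $$\Delta^k_Y=\big[\mathcal{I},\ -2\mathcal{I}_{\mathcal{X}}(\mathbb{I}_n\otimes(K_Y^{k-1})^T)-2\mathcal{I}_{\mathcal{X}\mathcal{V}}\big],\quad \Theta^k_Y=\mathcal{I}_{\mathcal{X}}\,vec\big(-(K_Y^{k-1})^TRK_Y^{k-1}\big),$$ define symmetric $P^k,Y^k\in\mathbb{R}^{n\times n}$ and $\mathcal{L}^k,\mathcal{L}^k_Y\in\mathbb{R}^{m\times n}$ by $$\begin{bmatrix}vecs(P^k)\\ vec(\mathcal{L}^k)\end{bmatrix}=(\Delta^k)^\dagger\Theta^k,\qquad \begin{bmatrix}vecs(Y^k)\\ vec(\mathcal{L}^k_Y)\end{bmatrix}=(\Delta^k_Y)^\dagger\Theta^k_Y,$$ and update $K^k=R^{-1}\mathcal{L}^k$, $K_Y^k=R^{-1}\mathcal{L}_Y^k$. The iteration is considered without the numerical stopping test, so that infinite sequences are generated. *)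

(* Defs.v *)
From HB Require Import structures.
From mathcomp Require Import all_boot all_order all_algebra.
From mathcomp Require Import complex mxtens.
From mathcomp Require Import all_classical all_reals all_analysis.

Set Implicit Arguments.
Unset Strict Implicit.
Unset Printing Implicit Defensive.

Import Order.TTheory GRing.Theory Num.Theory.
Import numFieldNormedType.Exports.

Local Open Scope classical_set_scope.
Local Open Scope ring_scope.

Section Matrices.
Context {R : realType}.

Definition cspectrum (n : nat) (M : 'M[R]_n) : pred R[i] :=
  eigenvalue (map_mx (real_complex R) M).

Definition hurwitz (n : nat) (M : 'M[R]_n) : Prop :=
  forall z : R[i], cspectrum M z -> complex.Re z < 0.

Definition stabilizable (n m : nat) (A : 'M[R]_n) (B : 'M[R]_(n, m)) : Prop :=
  exists K : 'M[R]_(m, n), hurwitz (A - B *m K).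

Definition posdef (n : nat) (M : 'M[R]_n) : Prop :=
  M^T = M /\ forall v : 'cV[R]_n, v != 0 -> 0 < (v^T *m M *m v) 0 0.

Definition possemidef (n : nat) (M : 'M[R]_n) : Prop :=
  M^T = M /\ forall v : 'cV[R]_n, 0 <= (v^T *m M *m v) 0 0.

Definition penrose (m n : nat) (A : 'M[R]_(m, n)) (X : 'M[R]_(n, m)) : Prop :=
  [/\ A *m X *m A = A, X *m A *m X = X,
      (A *m X)^T = A *m X & (X *m A)^T = X *m A].

(* The default value 0 is never used, see [pinvP]. *)
Definition pinv (m n : nat) (A : 'M[R]_(m, n)) : 'M[R]_(n, m) :=
  xget 0 [set X | penrose A X].

Lemma gram_unit (m n : nat) (A : 'M[R]_(m, n)) :
  row_free A -> A *m A^T \in unitmx.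
Proof.
move=> fA; rewrite -row_free_unit -kermx_eq0.
apply/eqP/row_matrixP => i; rewrite row0.
set v := row i _.
have vG : v *m (A *m A^T) = 0.
  by rewrite -row_mul mulmx_ker row0.
have w0 : (v *m A) *m (v *m A)^T = 0.
  by rewrite trmx_mul mulmxA -(mulmxA v) vG mul0mx.
apply: (row_free_inj fA); rewrite mul0mx; apply/rowP => j; rewrite [RHS]mxE.
have /matrixP/(_ 0 0) := w0; rewrite [RHS]mxE mxE => /eqP.
rewrite psumr_eq0; last by move=> k _; rewrite [_^T _ _]mxE -expr2 sqr_ge0.
move=> /allP/(_ j (mem_index_enum j)).
by rewrite [_^T _ _]mxE -expr2 sqrf_eq0 => /eqP.
Qed.

Lemma penrose_full_rank (m r n : nat) (L : 'M[R]_(m, r)) (U : 'M[R]_(r, n)) :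
  U *m U^T \in unitmx -> L^T *m L \in unitmx ->
  penrose (L *m U) (U^T *m invmx (U *m U^T) *m invmx (L^T *m L) *m L^T).
Proof.
move=> /mulmxV; set Gu := invmx _ => UGu.
move=> /mulVmx; set Gl := invmx _ => GlL.
have sGu : Gu^T = Gu by rewrite /Gu trmx_inv trmx_mul trmxK.
have sGl : Gl^T = Gl by rewrite /Gl trmx_inv trmx_mul trmxK.
have AX : L *m U *m (U^T *m Gu *m Gl *m L^T) = L *m Gl *m L^T.
  by rewrite !mulmxA -(mulmxA L U) -(mulmxA L (U *m _)) UGu mulmx1.
have XA : (U^T *m Gu *m Gl *m L^T) *m (L *m U) = U^T *m Gu *m U.
  by rewrite !mulmxA -(mulmxA _ L^T L) -(mulmxA _ Gl) GlL mulmx1.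
split.
- by rewrite AX !mulmxA -(mulmxA _ L^T L) -(mulmxA _ Gl) GlL mulmx1.
- rewrite XA !mulmxA -(mulmxA _ U U^T) -(mulmxA _ (U *m _)) UGu.
  by rewrite mulmx1.
- by rewrite AX !trmx_mul trmxK sGl mulmxA.
- by rewrite XA !trmx_mul trmxK sGu mulmxA.
Qed.

Lemma penrose_ex (m n : nat) (A : 'M[R]_(m, n)) : exists X, penrose A X.
Proof.
have uU : row_base A *m (row_base A)^T \in unitmx.
  by apply: gram_unit; exact: row_base_free.
have uL : (col_base A)^T *m col_base A \in unitmx.
  rewrite -{2}(trmxK (col_base A)); apply: gram_unit.
  by rewrite /row_free mxrank_tr -/(row_full _) col_base_full.
by have := penrose_full_rank uU uL; rewrite mulmx_base; eexists; eassumption.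
Qed.

Lemma penrose_inj (m n : nat) (A : 'M[R]_(m, n)) X Y :
  penrose A X -> penrose A Y -> X = Y.
Proof.
move=> [X1 X2 X3 X4] [Y1 Y2 Y3 Y4].
have AXY : A *m X = A *m Y.
  rewrite -X3 -{1}Y1 -[_ *m A *m X]mulmxA trmx_mul X3 Y3.
  by rewrite mulmxA X1.
have XYA : X *m A = Y *m A.
  rewrite -X4 -{1}Y1 !mulmxA -(mulmxA (X *m A)) trmx_mul X4 Y4.
  by rewrite -mulmxA (mulmxA A) X1.
by rewrite -X2 -mulmxA AXY mulmxA XYA.
Qed.

Lemma pinvP (m n : nat) (A : 'M[R]_(m, n)) : penrose A (pinv A).
Proof. by have [X AX] := penrose_ex A; apply: (xgetPex 0); exists X. Qed.

(* The pairs (i, j) with i <= j, in lexicographic order. *)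
Definition upper_seq (n : nat) : seq ('I_n * 'I_n) :=
  [seq (i, j) | i : 'I_n <- enum 'I_n, j <- [seq j : 'I_n <- enum 'I_n | (i <= j)%N]].

Lemma size_upper_seq (n : nat) : size (upper_seq n) == (n * n.+1)./2.
Proof.
rewrite size_allpairs_dep sumnE big_map big_enum /=.
rewrite (eq_bigr (fun i : 'I_n => (n - i)%N)); last first.
  move=> i _; rewrite size_filter -(count_map val (fun j => i <= j)%N).
  rewrite val_enum_ord -size_filter.
  rewrite -[n in iota 0 n](subnKC (ltnW (ltn_ord i))) iotaD filter_cat size_cat.
  rewrite add0n !size_filter (eq_in_count (a2 := pred0)); last first.
    by move=> k; rewrite mem_iota add0n /= => ki; rewrite leqNgt ki.
  rewrite count_pred0 (eq_in_count (a2 := predT)); last first.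
    by move=> k; rewrite mem_iota => /andP[->].
  by rewrite count_predT size_iota.
rewrite (reindex_inj rev_ord_inj) /=.
rewrite (eq_bigr (fun i : 'I_n => (i.+1)%N)); last first.
  by move=> i _; rewrite subKn.
have -> : (\sum_(i < n) i.+1 = \sum_(i < n.+1) i)%N.
  by rewrite big_ord_recl add0n.
by rewrite -(big_mkord xpredT id) (bin2_sum n.+1) bin2 /= mulnC.
Qed.

Definition upper_pairs (n : nat) : (n * n.+1)./2.-tuple ('I_n * 'I_n) :=
  Tuple (size_upper_seq n).

Definition vecs (n : nat) (S : 'M[R]_n) : 'cV[R]_((n * n.+1)./2) :=
  \col_k let: (i, j) := tnth (upper_pairs n) k in
         if i == j then S i j else 2 * S i j.

Definition quadmon (n : nat) (z : 'cV[R]_n) : 'cV[R]_((n * n.+1)./2) :=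
  \col_k let: (i, j) := tnth (upper_pairs n) k in z i 0 * z j 0.

(* Column stacking: the entry of index j * m + i is M i j. *)
Definition vec (m n : nat) (M : 'M[R]_(m, n)) : 'cV[R]_(n * m) :=
  \col_k M (mxtens_unindex k).2 (mxtens_unindex k).1.

Definition normsq (n : nat) (v : 'cV[R]_n) : R := \sum_i v i 0 ^+ 2.

Definition mxint (p q : nat) (a b : R) (F : R -> 'M[R]_(p, q)) : 'M[R]_(p, q) :=
  \matrix_(i, j) \int[lebesgue_measure]_(t in `[a, b]) F t i j.

End Matrices.

Section Processes.
Context {R : realType} {disp : measure_display} {T : measurableType disp}.

Definition random_vector (n : nat) (X : T -> 'cV[R]_n) : Prop :=
  forall i, measurable_fun setT (fun w => X w i 0).

Definition measurable_process (n : nat) (X : R -> T -> 'cV[R]_n) : Prop :=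
  forall i, measurable_fun (`[(0 : R), +oo[ `*` [set: T])
    (fun tw : R * T => X tw.1 tw.2 i 0).

Definition generated_sigma (I : Type) (D : set I) (X : I -> T -> R) :
    set (set T) :=
  <<s [set E | exists i (U : set R), [/\ D i, measurable U & E = X i @^-1` U]]>>.

Definition sigma_vector (n : nat) (X : T -> 'cV[R]_n) : set (set T) :=
  generated_sigma [set: 'I_n] (fun i w => X w i 0).

Definition sigma_process (n : nat) (D : set R) (X : R -> T -> 'cV[R]_n) :
    set (set T) :=
  generated_sigma (D `*` [set: 'I_n])
    (fun ti w => X ti.1 w ti.2 0).

Definition natural_filtration (n : nat) (X : R -> T -> 'cV[R]_n) (t : R) :
    set (set T) :=
  sigma_process `[0, t] X.

Definition adapted (n : nat) (F : R -> set (set T)) (X : R -> T -> 'cV[R]_n) :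
    Prop :=
  forall t i (U : set R), 0 <= t -> measurable U ->
    F t ((fun w => X t w i 0) @^-1` U).

Variable P : probability T R.

Definition independent_sigma (F G : set (set T)) : Prop :=
  forall E E', F E -> G E' -> P (E `&` E') = (P E * P E')%E.

(* Subfamilies are covered by taking [U i = setT]. *)
Definition independent_family (I : finType) (X : I -> T -> R) : Prop :=
  forall U : I -> set R, (forall i, measurable (U i)) ->
    P (\bigcap_(i in [set: I]) (X i @^-1` U i)) =
    (\prod_(i : I) P (X i @^-1` U i))%E.

Record brownian_motion (p : nat) (W : R -> T -> 'cV[R]_p) : Prop := {
  bm_random : forall t, 0 <= t -> random_vector (W t);
  bm_start : {ae P, forall w, W 0 w = 0};
  bm_continuous : {ae P, forall w, forall k,
    {within `[0, +oo[, continuous (fun t => W t w k 0)}};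
  (* [normal_prob] takes the standard deviation as its second parameter. *)
  bm_gaussian : forall s t k (U : set R), 0 <= s -> s < t -> measurable U ->
    P ((fun w => W t w k 0 - W s w k 0) @^-1` U) =
    normal_prob 0 (Num.sqrt (t - s)) U;
  bm_independent : forall (N : nat) (t : nat -> R),
    0 <= t 0%N -> (forall l, t l < t l.+1) ->
    independent_family (fun (lk : 'I_N * 'I_p) w =>
      W (t lk.1.+1) w lk.2 0 - W (t lk.1) w lk.2 0)
}.

Record admissible (m p : nat) (rho : R) (W : R -> T -> 'cV[R]_p)
    (u : R -> T -> 'cV[R]_m) : Prop := {
  adm_measurable : measurable_process u;
  adm_adapted : adapted (natural_filtration W) u;
  adm_finite : (\int[P]_w \int[lebesgue_measure]_(t in `[0%R, +oo[)
    (expR (- (rho * t)) * normsq (u t w))%R%:E < +oo)%E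
}.

(* The noise being additive with a constant coefficient, the stochastic
   integral of C against W over [0, t] is C (W t - W 0) = C W t. *)
Record linear_sde_solution (n m p : nat)
    (A : 'M[R]_n) (B : 'M[R]_(n, m)) (C : 'M[R]_(n, p))
    (W : R -> T -> 'cV[R]_p) (u : R -> T -> 'cV[R]_m) (x0 : T -> 'cV[R]_n)
    (x : R -> T -> 'cV[R]_n) : Prop := {
  sde_measurable : measurable_process x;
  sde_continuous : {ae P, forall w, forall i,
    {within `[0, +oo[, continuous (fun t => x t w i 0)}};
  sde_equation : {ae P, forall w, forall t, 0 <= t ->
    x t w = x0 w + mxint 0 t (fun s => A *m x s w + B *m u s w) + C *m W t w}
}.

Definition mean (n : nat) (X : T -> 'cV[R]_n) : 'cV[R]_n :=
  \col_i fine 'E_P[fun w => X w i 0%R]%E.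

End Processes.

Section PolicyIteration.
Context {R : realType} {n m : nat}.
Variables (rho : R) (X : R -> 'cV[R]_n) (V : R -> 'cV[R]_m).
Variables (s : nat -> R) (d : nat).

Definition data_phi (a b : R) : 'rV[R]_((n * n.+1)./2) :=
  expR (- (rho * b)) *: (quadmon (X b))^T
  - expR (- (rho * a)) *: (quadmon (X a))^T.

Definition data_I : 'M[R]_(d, (n * n.+1)./2) :=
  \matrix_(j < d) data_phi (s j) (s j.+1).

Definition data_IX : 'M[R]_(d, n * n) :=
  \matrix_(j < d)
    mxint (s j) (s j.+1) (fun t => expR (- (rho * t)) *: (X t *t X t)^T).

Definition data_IXV : 'M[R]_(d, n * m) :=
  \matrix_(j < d)
    mxint (s j) (s j.+1) (fun t => expR (- (rho * t)) *: (X t *t V t)^T).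

Definition data_Delta (K : 'M[R]_(m, n)) :
    'M[R]_(d, (n * n.+1)./2 + n * m) :=
  row_mx data_I (- (2 *: (data_IX *m (1%:M *t K^T))) - 2 *: data_IXV).

(* [vecs] is a bijection from symmetric matrices onto column vectors, so [P']
   and [L'] are determined by [K] and [M]. *)
Definition pi_solve (M : 'M[R]_n) (K : 'M[R]_(m, n))
    (P' : 'M[R]_n) (L' : 'M[R]_(m, n)) : Prop :=
  P'^T = P' /\
  col_mx (vecs P') (vec L') = pinv (data_Delta K) *m (data_IX *m vec M).

End PolicyIteration.

(* Main.v *)
(* The mean X of the state solves X' = A X + B V in the integrated sense, because
   the Brownian term has mean zero and Fubini's theorem applies: the control is
   integrable in (t, w) since |u| <= 1 + |u|^2, the state by Gronwall's
   inequality.  The product rule for absolutely continuous functions then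
   expresses the increments of e^(-rho t) X X^T through the moments of (X, X) and
   (X, V), so each data equation is a linear combination of the entries of the
   discounted Lyapunov equation and of B^T P - L.  The rank condition makes these
   combinations injective: one step of the algorithm solves exactly the Lyapunov
   equation of Kleinman's iteration for A - (rho / 2) I.  Kleinman's iterates
   decrease to the stabilizing solution of the Riccati equation, for a positive
   semidefinite weight, which covers both Q and 0. *)

Require Import Defs.
From mathcomp Require Import all_boot all_order all_algebra.
From mathcomp Require Import complex mxtens spectral ring lra.
From mathcomp Require Import all_classical all_reals all_analysis.
From mathcomp Require Import measurable_realfun.

Set Implicit Arguments.
Unset Strict Implicit.
Unset Printing Implicit Defensive.

Import Order.TTheory GRing.Theory Num.Theory.
Import numFieldNormedType.Exports.

Local Open Scope classical_set_scope.
Local Open Scope ring_scope.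

(** * Lyapunov equations *)

(** Stability is handled without matrix exponentials: positivity of Lyapunov solutions comes from
    Schur triangularisation over the complex numbers, and stability of an improved gain from a
    Lyapunov identity evaluated on an eigenvector, carried as a pair of real vectors. The prescribed
    rank is the largest possible one, since the symmetric moments of (X, X) duplicate columns of
    [data_IX]. Injectivity therefore holds only against a symmetric residual, and the duplication
    has to be factored out first. The mean control is merely integrable in time, so the product rule
    cannot rest on classical derivatives; it is obtained from Fubini's theorem on the two sides of a
    diagonal. Fubini for the state presupposes the very integrability that Gronwall's inequality
    should deliver, a circle broken by truncation. The targets differ in why their closed loops are
    stable: for [Pstar] it follows from the Riccati equation with [Pstar] and [Q] definite, for
    [Ystar] it belongs to its definition. *)

Section ComplexLyapunov.
Variable C : numClosedFieldType.
Local Notation "M ^H" := (map_mx Num.conj (trmx M)) (at level 8, format "M ^H").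

Lemma conjmxM m n p (M : 'M[C]_(m, n)) (N : 'M[C]_(n, p)) :
  (M *m N)^H = N^H *m M^H.
Proof. by rewrite trmx_mul map_mxM. Qed.

Lemma conjmxK m n (M : 'M[C]_(m, n)) : (M^H)^H = M.
Proof. by apply/matrixP => i j; rewrite !mxE conjCK. Qed.

Lemma conjmxD m n (M N : 'M[C]_(m, n)) : (M + N)^H = M^H + N^H.
Proof. by rewrite linearD map_mxD. Qed.

Lemma conjmxZ m n a (M : 'M[C]_(m, n)) : (a *: M)^H = a^* *: M^H.
Proof. by rewrite linearZ map_mxZ. Qed.

Lemma hermitian_form_block n (w1 a : C) (w b : 'rV[C]_n) (D : 'M[C]_n) :
  (row_mx w1%:M w *m block_mx a%:M b b^H D *m (row_mx w1%:M w)^H) 0 0 =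
  a * (w1 * w1^*) + w1 * (b *m w^H) 0 0 + w1^* * ((b *m w^H) 0 0)^*
    + (w *m D *m w^H) 0 0.
Proof.
rewrite tr_row_mx map_col_mx mul_row_block mul_row_col mxE.
rewrite tr_scalar_mx map_scalar_mx /= !mul_scalar_mx mul_mx_scalar mulmxDl.
have -> : w *m b^H = (b *m w^H)^H by rewrite conjmxM conjmxK.
rewrite -scalemxAl; set t := b *m _; set q := _ *m _ *m _.
by rewrite !mxE eqxx mulr1n; ring.
Qed.

Lemma unitmx_trig_neg n (A : 'M[C]_n) : is_trig_mx A ->
  (forall i, A i i + (A i i)^* < 0) -> A^H \in unitmx.
Proof.
move=> trA dA; rewrite map_unitmx unitmx_tr unitmxE det_trig // unitfE.
apply/prodf_neq0 => i _; apply: contraTneq (dA i) => ->.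
by rewrite conjC0 addr0 ltxx.
Qed.

(* Induction on the size.  If the corner entry [a] of [X] is positive, the
   Schur complement of [a] satisfies the inequality for the smaller triangular
   matrix; if [a = 0], the first row of [X] is forced to vanish. *)
Lemma lyapunov_psd_trig n (T : 'M[C]_n) : is_trig_mx T ->
  (forall i, T i i + (T i i)^* < 0) ->
  forall X, X^H = X ->
  (forall v : 'rV[C]_n, (v *m (T *m X + X *m T^H) *m v^H) 0 0 <= 0) ->
  forall v : 'rV[C]_n, 0 <= (v *m X *m v^H) 0 0.
Proof.
elim/trigsqmx_ind => {n T} [|n x c A trA IH] dT X hX neg v.
  by rewrite [v]thinmx0 !mul0mx mxE.
have dA i : A i i + (A i i)^* < 0.
  by have := dT (rshift 1 i); rewrite block_mxEdr.
set x0 := x 0 0.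
have x0E : x = x0%:M by rewrite [LHS]mx11_scalar.
have dx : x0 + x0^* < 0 by have := dT (lshift n 0); rewrite block_mxEul.
pose a := X (lshift n 0) (lshift n 0).
pose b := ursubmx (X : 'M[C]_(1 + n)).
pose D := drsubmx (X : 'M[C]_(1 + n)).
have XE : X = block_mx a%:M b b^H D.
  rewrite -[LHS](@submxK _ 1 n 1 n); congr block_mx.
    by rewrite [LHS]mx11_scalar; congr (_%:M); rewrite !mxE.
  by rewrite -[in LHS]hX; apply/matrixP => i j; rewrite !mxE.
have aR : a^* = a by rewrite /a -{2}hX !mxE.
have hD : D^H = D.
  by apply/matrixP => i j; rewrite -[in RHS]/D /D -[in RHS]hX !mxE.
clearbody a b D; move: neg; rewrite {hX}XE => neg.
pose N11 := (x0 + x0^*) * a.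
pose N12 := x0 *: b + a *: c^H + b *m A^H.
pose N22 := c *m b + A *m D + (b^H *m c^H + D *m A^H).
have NE : block_mx x 0 c A *m block_mx a%:M b b^H D +
     block_mx a%:M b b^H D *m (block_mx x 0 c A)^H = block_mx N11%:M N12 N12^H N22.
  rewrite tr_block_mx map_block_mx !mulmx_block add_block_mx trmx0 map_mx0.
  rewrite !mulmx0 !mul0mx ?addr0 ?add0r.
  rewrite x0E tr_scalar_mx map_scalar_mx /= !mul_scalar_mx !mul_mx_scalar.
  congr block_mx.
  - by rewrite !scale_scalar_mx -raddfD /= /N11 mulrDl (mulrC a).
  - by rewrite /N12 addrA.
  - rewrite /N12 !conjmxD conjmxM !conjmxZ !conjmxK aR.
    by rewrite addrAC (addrC (a *: c)).
have {NE}neg (w1 : C) (w : 'rV[C]_n) :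
    N11 * (w1 * w1^*) + w1 * (N12 *m w^H) 0 0
       + w1^* * ((N12 *m w^H) 0 0)^* + (w *m N22 *m w^H) 0 0 <= 0.
  by have := neg (row_mx w1%:M w); rewrite NE hermitian_form_block.
(* At the first basis vector the hypothesis reads 2 Re(x0) a <= 0, with Re(x0) < 0. *)
have a0 : 0 <= a.
  have := neg 1 0; rewrite trmx0 map_mx0 !mulmx0.
  have -> : (0 : 'M[C]_1) 0 0 = 0 by rewrite mxE.
  by rewrite conjC0 conjC1 !mulr1 !mulr0 !addr0 /N11 nmulr_rle0.
have [w1 [w ->]] : exists w1 w, v = row_mx w1%:M w.
  exists ((lsubmx (v : 'M[C]_(1, 1 + n))) 0 0), (rsubmx (v : 'M[C]_(1, 1 + n))).
  by rewrite -mx11_scalar hsubmxK.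
rewrite hermitian_form_block.
have [a_eq0|a_neq0] := eqVneq a 0.
  have N11_0 : N11 = 0 by rewrite /N11 a_eq0 mulr0.
  have N12_0 : N12 = 0.
    apply/rowP => j; rewrite [RHS]mxE; apply/eqP; apply: contraT => N12j.
    pose w' : 'rV[C]_n := delta_mx 0 j; pose z := N12 0 j.
    have zE : (N12 *m w'^H) 0 0 = z.
      have -> : w'^H = delta_mx j 0.
        by apply/matrixP => i k; rewrite !mxE andbC conjC_nat.
      by rewrite -colE mxE.
    have p_gt0 : 0 < z * z^* by rewrite -normCK exprn_gt0 // normr_gt0.
    set q := (w' *m N22 *m w'^H) 0 0.
    have q_le0 : q <= 0.
      have := neg 0 w'; rewrite conjC0 !mul0r mulr0 !add0r; exact.
    have qR : q^* = q by apply/CrealP; rewrite realE q_le0 orbT.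
    (* This scaling gives the form the value 2 (1 - q) + q = 2 - q, which is positive because
       [q <= 0]. *)
    pose k := (1 - q) / (z * z^*).
    have kR : k^* = k.
      by rewrite /k fmorph_div rmorphB rmorphM /= conjCK conjC1 qR (mulrC z).
    have := neg (k * z^*) w'; rewrite N11_0 mul0r add0r zE -/q.
    rewrite rmorphM /= kR conjCK.
    have -> : k * z^* * z + k * z * z^* + q = 2 - q.
      rewrite -mulrA (mulrC z^*) -mulrA -mulrDr /k -mulr2n mulrnAr divfK ?gt_eqF //.
      by ring.
    by rewrite lt_geF // subr_gt0 (le_lt_trans q_le0).
  (* With [a = 0], the vanishing of [N12] is the Sylvester equation x0 b + b A^H = 0; x0 I + A^H is
     triangular with diagonal entries of negative real part, hence invertible. *)
  have b0 : b = 0.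
    pose S := x0^*%:M + A.
    have uS : S^H \in unitmx.
      apply: unitmx_trig_neg => [|i]; last first.
        rewrite !mxE eqxx mulr1n rmorphD /= conjCK addrACA (addrC x0^*).
        by rewrite -oppr_gt0 opprD addr_gt0 ?oppr_gt0.
      apply/is_trig_mxP => i j ij; move/is_trig_mxP: trA => /(_ i j ij) Aij.
      by rewrite !mxE Aij -val_eqE (ltn_eqF ij) addr0.
    rewrite -[LHS](mulmxK uS) /S conjmxD tr_scalar_mx map_scalar_mx /= conjCK.
    have := N12_0; rewrite /N12 a_eq0 scale0r addr0 => N12_0'.
    by rewrite mulmxDr mul_mx_scalar N12_0' mul0mx.
  rewrite a_eq0 b0 mul0r !mul0mx mxE conjC0 !mulr0 !add0r.
  apply: IH => // w'; have := neg 0 w'.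
  by rewrite conjC0 !mul0r mulr0 !add0r /N22 b0 trmx0 map_mx0 mulmx0 !mul0mx !add0r.
have a_gt0 : 0 < a by rewrite lt_def a_neq0.
pose S := D - a^-1 *: (b^H *m b).
have formM (w' : 'rV[C]_n) (p : 'cV[C]_n) (r : 'rV[C]_n) :
    (w' *m (p *m r) *m w'^H) 0 0 = (w' *m p) 0 0 * (r *m w'^H) 0 0.
  by rewrite !mulmxA -(mulmxA (w' *m p)) mxE big_ord1.
have formD (w' : 'rV[C]_n) (M N : 'M[C]_n) :
    (w' *m (M + N) *m w'^H) 0 0 = (w' *m M *m w'^H) 0 0 + (w' *m N *m w'^H) 0 0.
  by rewrite mulmxDr mulmxDl mxE.
have formZ (w' : 'rV[C]_n) k (M : 'M[C]_n) :
    (w' *m (k *: M) *m w'^H) 0 0 = k * (w' *m M *m w'^H) 0 0.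
  by rewrite -scalemxAr -scalemxAl mxE.
have formH (w' : 'rV[C]_n) (r : 'rV[C]_n) : (r *m w'^H) 0 0 = ((w' *m r^H) 0 0)^*.
  by rewrite -[in LHS](conjmxK r) -conjmxM !mxE.
have formN (w' : 'rV[C]_n) (M : 'M[C]_n) :
    (w' *m (- M) *m w'^H) 0 0 = - (w' *m M *m w'^H) 0 0.
  by rewrite mulmxN mulNmx mxE.
have SE (w' : 'rV[C]_n) : (w' *m S *m w'^H) 0 0 =
    (w' *m D *m w'^H) 0 0 - (w' *m b^H) 0 0 * ((w' *m b^H) 0 0)^* / a.
  by rewrite /S formD formN formZ formM (formH _ b) mulrC.
have posS : 0 <= (w *m S *m w^H) 0 0.
  apply: IH => // [|w'].
    by rewrite /S -scaleNr conjmxD conjmxZ conjmxM conjmxK hD rmorphN /= fmorphV /= aR.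
  set be := (w' *m b^H) 0 0; pose de := (w' *m (A *m b^H)) 0 0.
  (* This first component minimises the form of [X] in [w1]; there the form of the block inequality
     equals that of the Schur complement. *)
  have := neg (- (be / a)) w'.
  have -> : (w' *m (A *m S + S *m A^H) *m w'^H) 0 0 =
      (w' *m (A *m D) *m w'^H) 0 0 + (w' *m (D *m A^H) *m w'^H) 0 0
      - (de * be^* + be * de^*) / a.
    rewrite /S mulmxBr mulmxBl -scalemxAr -scalemxAl !formD !formN !formZ.
    rewrite (mulmxA A b^H) -(mulmxA b^H b) !formM (formH _ b).
    rewrite (formH _ (b *m _)) conjmxM conjmxK -/be -/de.
    by field.
  have -> : (N12 *m w'^H) 0 0 = x0 * be^* + a * ((w' *m c) 0 0)^* + de^*.
    by rewrite (formH _ N12) /N12 !conjmxD !conjmxZ conjmxM !conjmxK !mulmxDr -!scalemxAr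
      ![fun_of_matrix (_ + _) 0 0]mxE ![fun_of_matrix (_ *: _) 0 0]mxE !rmorphD !rmorphM /= !conjCK.
  have -> : (w' *m N22 *m w'^H) 0 0 = (w' *m c) 0 0 * be^*
     + (w' *m (A *m D) *m w'^H) 0 0
     + (be * ((w' *m c) 0 0)^* + (w' *m (D *m A^H) *m w'^H) 0 0).
    by rewrite /N22 !formD !formM (formH _ b) (formH _ c^H) conjmxK.
  have -> : (- (be / a))^* = - (be^* / a).
    by rewrite rmorphN /= rmorphM /= fmorphV /= aR.
  rewrite /N11 !rmorphD !rmorphM /= !conjCK aR.
  apply: le_trans; rewrite le_eqVlt; apply/orP; left; apply/eqP.
  by field.
rewrite (formH _ b); set be := (w *m b^H) 0 0.
(* Completing the square in [w1]. *)
have -> : a * (w1 * w1^*) + w1 * be^* + w1^* * be^*^* + (w *m D *m w^H) 0 0 =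
   a * ((w1 + be / a) * (w1 + be / a)^*) + (w *m S *m w^H) 0 0.
  by rewrite SE -/be rmorphD /= rmorphM /= fmorphV /= aR conjCK; field.
by rewrite addr_ge0 // mulr_ge0 // mul_conjC_ge0.
Qed.
End ComplexLyapunov.

Lemma eigenvalue_unitmx (F : fieldType) n (M : 'M[F]_n) a :
  eigenvalue M a = (M - a%:M \notin unitmx).
Proof. by rewrite /eigenvalue /eigenspace kermx_eq0 row_free_unit. Qed.

Section ComplexLyapunovGeneral.
Variable C : numClosedFieldType.
Local Notation "M ^H" := (map_mx Num.conj (trmx M)) (at level 8, format "M ^H").

(** A unitary change of basis makes [M] triangular and preserves both Hermitian forms; the diagonal
    entries obtained are eigenvalues of [M], so their real parts are negative. The empty matrix is
    set apart because the Schur form asks for a positive size. *)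
Lemma lyapunov_psd_complex n (M X : 'M[C]_n) :
  (forall z, eigenvalue M z -> z + z^* < 0) -> X^H = X ->
  (forall v : 'rV[C]_n, (v *m (M *m X + X *m M^H) *m v^H) 0 0 <= 0) ->
  forall v : 'rV[C]_n, 0 <= (v *m X *m v^H) 0 0.
Proof.
case: n M X => [|n] M X eM hX neg v; first by rewrite [v]thinmx0 !mul0mx mxE.
have [P uP] := Schur M (ltn0Sn n); rewrite /similar_to /= conjymx // => trT0.
have [T TE] : exists T, T = P *m M *m P^H by eexists.
have {trT0} trT : is_trig_mx T by rewrite TE.
have PP : P *m P^H = 1%:M by apply/unitarymxP.
have PP' : P^H *m P = 1%:M by apply: mulmx1C.
have dT i : T i i + (T i i)^* < 0.
  apply: eM; rewrite eigenvalue_unitmx.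
  have -> : M - (T i i)%:M = P^H *m (T - (T i i)%:M) *m P.
    rewrite mulmxBr mulmxBl mul_mx_scalar -scalemxAl PP' scalemx1; congr (_ - _).
    by rewrite TE !mulmxA PP' mul1mx -(mulmxA M) PP' mulmx1.
  rewrite !unitmx_mul negb_and negb_and; apply/orP; left; apply/orP; right.
  rewrite unitmxE det_trig ?unitfE; last first.
    apply/is_trig_mxP => j k jk; move/is_trig_mxP: trT => /(_ j k jk) Tjk.
    by rewrite !mxE Tjk -val_eqE (ltn_eqF jk) subr0.
  by apply/negPn/eqP; rewrite (bigD1 i) //= !mxE eqxx mulr1n subrr mul0r.
have conjP (N : 'M[C]_n.+1) (w : 'rV[C]_n.+1) :
    w *m (P *m N *m P^H) *m w^H = (w *m P) *m N *m (w *m P)^H.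
  by rewrite conjmxM !mulmxA.
have vE : v = (v *m P^H) *m P by rewrite -mulmxA PP' mulmx1.
rewrite vE -conjP; apply: (lyapunov_psd_trig trT dT) => [|w].
  by rewrite !conjmxM conjmxK hX mulmxA.
have -> : T *m (P *m X *m P^H) + P *m X *m P^H *m T^H =
    P *m (M *m X + X *m M^H) *m P^H.
  rewrite TE !conjmxM conjmxK mulmxDr mulmxDl !mulmxA.
  by rewrite -(mulmxA _ P^H P) PP' mulmx1 -(mulmxA (P *m X) P^H P) PP' mulmx1.
by rewrite conjP.
Qed.
End ComplexLyapunovGeneral.

Section RealLyapunov.
Variable R : realType.
Local Notation "M ^H" := (map_mx Num.conj (trmx M)) (at level 8, format "M ^H").
Local Notation cplx := (map_mx (real_complex R)).

Lemma complex_rowE n (v : 'rV[R[i]]_n) :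
  v = cplx (map_mx (@complex.Re R) v) + 'i%C *: cplx (map_mx (@complex.Im R) v).
Proof. by apply/rowP => j; rewrite !mxE; exact: complexE. Qed.

Lemma conj_cplx m n (M : 'M[R]_(m, n)) : (cplx M)^H = cplx M^T.
Proof. by apply/matrixP => i j; rewrite !mxE; exact: conjc_real. Qed.

Lemma sym_form_comm n (N : 'M[R]_n) (a b : 'rV[R]_n) : N^T = N ->
  a *m N *m b^T = b *m N *m a^T.
Proof.
move=> sN; have -> : a *m N *m b^T = (b *m N *m a^T)^T.
  by rewrite !trmx_mul trmxK sN mulmxA.
by apply/matrixP => i j; rewrite !ord1 mxE.
Qed.

(** The cross terms cancel because [N] is symmetric. *)
Lemma cplx_form n (N : 'M[R]_n) (a b : 'rV[R]_n) : N^T = N ->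
  ((cplx a + 'i%C *: cplx b) *m cplx N *m (cplx a + 'i%C *: cplx b)^H) 0 0 =
  ((a *m N *m a^T) 0 0 + (b *m N *m b^T) 0 0)%:C%C.
Proof.
move=> sN; rewrite conjmxD conjmxZ !conj_cplx.
rewrite mulmxDl mulmxDr !mulmxDl -!scalemxAr -!scalemxAl -!map_mxM /=.
rewrite (sym_form_comm b a sN) scalerA.
set p := a *m N *m a^T; set q := a *m N *m b^T; set r := b *m N *m b^T.
have iJ : ('i%C : R[i])^* = - 'i%C by apply/eqP; rewrite eq_complex /= oppr0 !eqxx.
rewrite iJ mulNr -expr2 sqr_i opprK scale1r scaleNr !mxE rmorphD /=.
by rewrite addrA addrK.
Qed.

(** The two equations are the real and imaginary parts of M (a + i b) = (al + i be) (a + i b). Since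
    [eigenvalue] speaks of row vectors, the proof passes through the transpose, which has the same
    spectrum. *)
Lemma hurwitzP n (M : 'M[R]_n) : hurwitz M <->
  forall (al be : R) (a b : 'cV[R]_n), (a != 0) || (b != 0) ->
    M *m a = al *: a - be *: b -> M *m b = be *: a + al *: b -> al < 0.
Proof.
have eT z : cspectrum M z = eigenvalue (cplx M^T) z.
  rewrite /cspectrum !eigenvalue_unitmx -unitmx_tr linearB /= tr_scalar_mx.
  by rewrite map_trmx.
split=> [hM al be a b ab0 Ma Mb|hM z].
  apply: (hM (al +i* be)%C); rewrite eT; apply/eigenvalueP.
  exists (cplx a^T + 'i%C *: cplx b^T).
    rewrite mulmxDl -scalemxAl -!map_mxM /= -!trmx_mul Ma Mb.
    apply/rowP => j; rewrite !mxE; simpc.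
    by rewrite (addrC (be * _)).
  apply: contraTneq ab0 => /rowP ab0; rewrite negb_or !negbK.
  apply/andP; split; apply/eqP/colP => j; have := ab0 j; rewrite !mxE; simpc; by case.
rewrite eT => /eigenvalueP[v]; rewrite [v]complex_rowE.
set a := map_mx _ v; set b := map_mx _ v => vM v0.
apply: (hM (complex.Re z) (complex.Im z) a^T b^T).
- apply: contraNT v0; rewrite negb_or !negbK => /andP[/eqP ha /eqP hb].
  by rewrite -(trmxK a) -(trmxK b) ha hb !trmx0 !map_mx0 scaler0 addr0.
- apply/colP => j; move/rowP: vM => /(_ j).
  have -> : M *m a^T = (a *m M^T)^T by rewrite trmx_mul trmxK.
  rewrite mulmxDl -scalemxAl -!map_mxM /=.
  by rewrite !mxE; case: z => x y; simpc => -[].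
- apply/colP => j; move/rowP: vM => /(_ j).
  have -> : M *m b^T = (b *m M^T)^T by rewrite trmx_mul trmxK.
  rewrite mulmxDl -scalemxAl -!map_mxM /=.
  by rewrite !mxE; case: z => x y; simpc => -[_ ->]; rewrite addrC.
Qed.

Lemma lyapunov_psd n (M X : 'M[R]_n) : hurwitz M -> X^T = X ->
  (forall v : 'cV[R]_n, (v^T *m (M^T *m X + X *m M) *m v) 0 0 <= 0) ->
  possemidef X.
Proof.
move=> hM sX neg; split=> // v.
have fR (r : R) : (0 <= r) = (0 <= r%:C%C :> R[i]) by rewrite lecR.
have sN : (M^T *m X + X *m M)^T = M^T *m X + X *m M.
  by rewrite linearD /= !trmx_mul trmxK sX addrC.
have -> : (v^T *m X *m v) 0 0 =
    (v^T *m X *m v^T^T) 0 0 + ((0 : 'rV[R]_n) *m X *m (0 : 'rV[R]_n)^T) 0 0.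
  by rewrite trmxK !mul0mx [X in _ + X]mxE addr0.
rewrite fR -cplx_form //; apply: (@lyapunov_psd_complex _ _ (cplx M^T)).
- move=> z ez; have : complex.Re z < 0.
    apply: hM; rewrite /cspectrum eigenvalue_unitmx -unitmx_tr linearB /=.
    by rewrite tr_scalar_mx -eigenvalue_unitmx map_trmx.
  move=> zN; rewrite [_ + _](addcJ z) pmulr_rlt0 ?ltr0n //.
  by rewrite ltcR.
- by rewrite conj_cplx sX.
- move=> w; rewrite [w]complex_rowE conj_cplx trmxK -!map_mxM -map_mxD cplx_form //.
  rewrite lecR; set a := map_mx _ w; set b := map_mx _ w.
  have := neg a^T; have := neg b^T; rewrite !trmxK => h1 h2.
  by rewrite -[leRHS](addr0 0) lerD.
Qed.

Lemma hurwitz_tr_block n (M : 'M[R]_n) :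
  hurwitz M -> hurwitz (block_mx M 0 0 M : 'M[R]_(n + n)).
Proof.
move/hurwitzP => hM; apply/hurwitzP => al be a b ab.
rewrite -[a]vsubmxK -[b]vsubmxK !mul_block_col !mul0mx !addr0 !add0r.
rewrite !scale_col_mx add_col_mx opp_col_mx add_col_mx.
move=> /eq_col_mx[a1 a2] /eq_col_mx[b1 b2].
have [z1|] := boolP ((usubmx a != 0) || (usubmx b != 0)).
  exact: hM z1 a1 b1.
have [z2 _|] := boolP ((dsubmx a != 0) || (dsubmx b != 0)).
  exact: hM z2 a2 b2.
rewrite !negb_or !negbK => /andP[/eqP da /eqP db] /andP[/eqP ua /eqP ub].
have a0 : a = 0 by rewrite -[a]vsubmxK ua da col_mx0.
have b0 : b = 0 by rewrite -[b]vsubmxK ub db col_mx0.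
by rewrite a0 b0 eqxx in ab.
Qed.

(** The quadratic form vanishes, and polarisation on basis vectors recovers every entry of a
    symmetric matrix. *)
Lemma psd_antisym n (X : 'M[R]_n) : possemidef X -> possemidef (- X) -> X = 0.
Proof.
move=> [sX pX] [_ nX].
have form0 (v : 'cV[R]_n) : (v^T *m X *m v) 0 0 = 0.
  apply/eqP; rewrite eq_le; apply/andP; split; last exact: pX.
  by have := nX v; rewrite mulmxN mulNmx mxE oppr_ge0.
apply/matrixP => i j; rewrite [RHS]mxE.
have formE k l : ((delta_mx k 0 : 'cV[R]_n)^T *m X *m (delta_mx l 0 : 'cV[R]_n)) 0 0 = X k l.
  by rewrite trmx_delta -rowE -colE !mxE.
have := form0 (delta_mx i 0 + delta_mx j 0).
have ii := form0 (delta_mx i 0); have jj := form0 (delta_mx j 0).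
rewrite formE in ii; rewrite formE in jj.
rewrite [(_ + _)^T]linearD /= mulmxDl mulmxDr !mulmxDl.
rewrite ![fun_of_matrix (_ + _) 0 0]mxE !formE ii jj.
have -> : X j i = X i j by rewrite -[in LHS]sX mxE.
by move=> h; lra.
Qed.

(* [X] need not be symmetric, so the inequality is applied to a symmetric matrix
   having [X] as an off-diagonal block. *)
Lemma lyapunov_inj n (M X : 'M[R]_n) : hurwitz M ->
  M^T *m X + X *m M = 0 -> X = 0.
Proof.
move=> /hurwitz_tr_block hM LX; pose X2 : 'M[R]_(n + n) := block_mx 0 X X^T 0.
have sX2 : X2^T = X2 by rewrite tr_block_mx !trmx0 trmxK.
have L2 : (block_mx M 0 0 M)^T *m X2 + X2 *m block_mx M 0 0 M = 0.
  rewrite tr_block_mx !trmx0 !mulmx_block add_block_mx.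
  rewrite !mul0mx !mulmx0 !add0r !addr0 LX.
  have -> : M^T *m X^T + X^T *m M = 0.
    by rewrite -[M in X in _ + X]trmxK -!trmx_mul -linearD /= addrC LX trmx0.
  by rewrite -(block_mx0 R).
have /psd_antisym X0 : possemidef X2.
  by apply: (lyapunov_psd hM sX2) => v; rewrite L2 mulmx0 mul0mx mxE.
have : X2 = 0.
  apply: X0; apply: (lyapunov_psd hM); first by rewrite linearN /= sX2.
  by move=> v; rewrite mulmxN mulNmx -opprD L2 oppr0 mulmx0 mul0mx mxE.
by rewrite -[0 in X in X -> _](@submxK _ n n n n) => /eq_block_mx[_ -> _ _];
  apply/matrixP => i j; rewrite !mxE.
Qed.

(** The Lyapunov operator, written as a matrix on vectorised matrices, is injective and hence
    invertible. The transpose of a solution solves the same equation, so uniqueness makes it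
    symmetric. *)
Lemma lyapunov_solve n (M S : 'M[R]_n) : hurwitz M -> S^T = S ->
  exists2 X : 'M[R]_n, X^T = X & M^T *m X + X *m M = S.
Proof.
move=> hM sS.
pose L := lin_mulmx M^T + lin_mulmxr M : 'M[R]_(n * n).
have LE X : mxvec X *m L = mxvec (M^T *m X + X *m M).
  by rewrite mulmxDr !mul_rV_lin /= !mxvecK linearD.
have uL : L \in unitmx.
  rewrite -row_free_unit -kermx_eq0; apply/eqP/row_matrixP => i; rewrite row0.
  have := mulmx_ker L; move/(congr1 (row i)); rewrite row_mul row0.
  rewrite -[row i _]vec_mxK LE => /(congr1 vec_mx); rewrite mxvecK linear0.
  by move/(lyapunov_inj hM) => ->; rewrite linear0.
pose X := vec_mx (mxvec S *m invmx L); have LX : M^T *m X + X *m M = S.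
  by apply: (can_inj mxvecK); rewrite -LE /X vec_mxK mulmxKV.
exists X => //; apply/eqP; rewrite -subr_eq0; apply/eqP/(lyapunov_inj hM).
have LXT : M^T *m X^T + X^T *m M = S.
  by rewrite -[RHS]sS -LX linearD /= !trmx_mul trmxK addrC.
by rewrite mulmxBr mulmxBl addrACA -opprD LX LXT subrr.
Qed.

End RealLyapunov.

(** * Kleinman's iteration *)

Section Kleinman.
Variable R : realType.

Definition lyap n (M X : 'M[R]_n) := M^T *m X + X *m M.

Lemma form_tr n (X : 'M[R]_n) (a b : 'cV[R]_n) :
  (a^T *m X *m b) 0 0 = (b^T *m X^T *m a) 0 0.
Proof.
have -> : a^T *m X *m b = (b^T *m X^T *m a)^T.
  by rewrite !trmx_mul !trmxK mulmxA.
by rewrite mxE.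
Qed.

Lemma psd_congr m n (S : 'M[R]_m) (K : 'M[R]_(m, n)) :
  possemidef S -> possemidef (K^T *m S *m K).
Proof.
move=> [sS pS]; split=> [|v]; first by rewrite !trmx_mul trmxK sS mulmxA.
by have := pS (K *m v); rewrite trmx_mul !mulmxA.
Qed.

Lemma psdD n (S S' : 'M[R]_n) :
  possemidef S -> possemidef S' -> possemidef (S + S').
Proof.
move=> [s p] [s' p']; split=> [|v]; first by rewrite linearD /= s s'.
by rewrite mulmxDr mulmxDl mxE addr_ge0.
Qed.

Lemma posdefW n (S : 'M[R]_n) : posdef S -> possemidef S.
Proof.
move=> [s p]; split=> // v; have [->|v0] := eqVneq v 0; last exact/ltW/p.
by rewrite mulmx0 mxE.
Qed.

Lemma posdef_unitmx n (S : 'M[R]_n) : posdef S -> S \in unitmx.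
Proof.
move=> [s p]; rewrite -row_free_unit -kermx_eq0; apply/eqP/row_matrixP => i.
rewrite row0; apply/eqP/contraT => v0.
have := p (row i (kermx S))^T; rewrite trmxK -row_mul mulmx_ker row0 mul0mx mxE.
by rewrite ltxx => ->//; apply: contraNneq v0 => v0; rewrite -[row _ _]trmxK v0 trmx0.
Qed.

Lemma posdef_form0 m n (S : 'M[R]_m) (K : 'M[R]_(m, n)) (v : 'cV[R]_n) :
  posdef S -> (v^T *m (K^T *m S *m K) *m v) 0 0 <= 0 -> K *m v = 0.
Proof.
move=> [s p] h; apply/eqP/contraT => /p; rewrite trmx_mul !mulmxA.
by move: h; rewrite !mulmxA => /le_gtF ->.
Qed.

Lemma lyap_psd n (M X S : 'M[R]_n) : hurwitz M -> X^T = X ->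
  lyap M X = - S -> possemidef S -> possemidef X.
Proof.
move=> hM sX LX [_ pS]; apply: (lyapunov_psd hM sX) => v.
by rewrite -/(lyap M X) LX mulmxN mulNmx mxE oppr_le0.
Qed.

Lemma lyapB n (M X Y : 'M[R]_n) : lyap M (X - Y) = lyap M X - lyap M Y.
Proof. by rewrite /lyap mulmxBr mulmxBl opprD addrACA. Qed.

(** For the eigenvector v = a + i b this is v^H (M^T X + X M) v = 2 al v^H X v in real terms; [be]
    cancels by symmetry of [X]. *)
Lemma lyap_eigen n (M X : 'M[R]_n) (al be : R) (a b : 'cV[R]_n) : X^T = X ->
  M *m a = al *: a - be *: b -> M *m b = be *: a + al *: b ->
  (a^T *m lyap M X *m a) 0 0 + (b^T *m lyap M X *m b) 0 0 =
  2 * al * ((a^T *m X *m a) 0 0 + (b^T *m X *m b) 0 0).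
Proof.
move=> sX Ma Mb.
have E (v w : 'cV[R]_n) : M *m v = w ->
    (v^T *m lyap M X *m v) 0 0 = 2 * (v^T *m X *m w) 0 0.
  move=> <-; rewrite /lyap mulmxDr mulmxDl mxE.
  have -> : v^T *m (M^T *m X) *m v = (M *m v)^T *m X *m v.
    by rewrite trmx_mul !mulmxA.
  by rewrite (form_tr X (M *m v) v) sX !mulmxA; ring.
rewrite (E _ _ Ma) (E _ _ Mb) mulmxBr mulmxDr -!scalemxAr.
rewrite ![fun_of_matrix (_ + _) 0 0]mxE ![fun_of_matrix (- _) 0 0]mxE.
rewrite ![fun_of_matrix (_ *: _) 0 0]mxE.
by rewrite (form_tr X b a) sX; ring.
Qed.

Variables (n m : nat) (F Q : 'M[R]_n) (B : 'M[R]_(n, m)) (Rm : 'M[R]_m).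
Hypotheses (pR : posdef Rm) (pQ : possemidef Q).
Let sR : Rm^T = Rm := proj1 pR.
Let uR : Rm \in unitmx := posdef_unitmx pR.
Let G := B *m invmx Rm *m B^T.

Definition gain (X : 'M[R]_n) := invmx Rm *m B^T *m X.

(** Since [Rm *m gain X = B^T *m X], the dependence on [B] becomes bilinear in the two gains, and
    the identities below reduce to completing squares. *)
Lemma lyap_gain (X : 'M[R]_n) (K : 'M[R]_(m, n)) : X^T = X ->
  lyap (F - B *m K) X =
  lyap F X - K^T *m Rm *m gain X - (gain X)^T *m Rm *m K.
Proof.
move=> sX.
have E : Rm *m gain X = B^T *m X by rewrite /gain !mulmxA mulmxV // mul1mx.
have E' : (gain X)^T *m Rm = X *m B.
  by rewrite -sR -trmx_mul E trmx_mul trmxK sX.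
rewrite -(mulmxA K^T) E E' /lyap linearB /= trmx_mul mulmxBl mulmxBr !mulmxA.
by rewrite addrACA !addrA.
Qed.

Lemma quadB (K L : 'M[R]_(m, n)) : (K - L)^T *m Rm *m (K - L) =
  K^T *m Rm *m K - K^T *m Rm *m L - L^T *m Rm *m K + L^T *m Rm *m L.
Proof.
rewrite [(K - L)^T]linearB /= !mulmxBl !mulmxBr.
move: (K^T *m _ *m K) (K^T *m _ *m L) (L^T *m _ *m K) (L^T *m _ *m L).
by move=> p q r s; apply/matrixP => i j; rewrite !mxE; ring.
Qed.

(** The policy-improvement identity: the surplus square in [K - gain X] is the source of both
    stability and monotonicity of the iteration. *)
Lemma lyap_improve (X : 'M[R]_n) (K : 'M[R]_(m, n)) : X^T = X ->
  lyap (F - B *m K) X = - (Q + K^T *m Rm *m K) ->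
  lyap (F - B *m gain X) X =
  - (Q + (gain X)^T *m Rm *m gain X + (K - gain X)^T *m Rm *m (K - gain X)).
Proof.
move=> sX; rewrite !lyap_gain // quadB.
move=> /eqP; rewrite 2!subr_eq => /eqP ->.
set L := gain X; move: (K^T *m _ *m K) (K^T *m _ *m L) (L^T *m _ *m K) (L^T *m _ *m L).
by move=> p q r s; apply/matrixP => i j; rewrite !mxE; ring.
Qed.

(** On an eigenvector with [al >= 0] the two sides of [lyap_eigen] have opposite signs, so every
    weight vanishes there. As [Rm] is definite, both gains annihilate the vector, which is then an
    eigenvector of [F - B *m K] for the same eigenvalue. *)
Lemma hurwitz_improve (X : 'M[R]_n) (K : 'M[R]_(m, n)) :
  hurwitz (F - B *m K) -> X^T = X ->
  lyap (F - B *m K) X = - (Q + K^T *m Rm *m K) ->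
  hurwitz (F - B *m gain X).
Proof.
move=> hK sX LX; have pKK := psd_congr K (posdefW pR).
have [_ pX] := lyap_psd hK sX LX (psdD pQ pKK).
apply/hurwitzP => al be a b ab Ma Mb; rewrite ltNge; apply/negP => al0.
have := lyap_eigen sX Ma Mb; rewrite (lyap_improve sX LX).
set L := gain X in Ma Mb *; set q := 2 * al * _ => EE; clearbody L.
have q0 : 0 <= q by rewrite !mulr_ge0 // addr_ge0.
have pL := proj2 (psd_congr L (posdefW pR)).
have pKL := proj2 (psd_congr (K - L) (posdefW pR)).
have negE (v : 'cV[R]_n) : (v^T *m (- (Q + L^T *m Rm *m L + (K - L)^T *m Rm *m (K - L))) *m v) 0 0
    = - ((v^T *m Q *m v) 0 0 + (v^T *m (L^T *m Rm *m L) *m v) 0 0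
         + (v^T *m ((K - L)^T *m Rm *m (K - L)) *m v) 0 0).
  rewrite mulmxN mulNmx !mulmxDr !mulmxDl.
  by rewrite ![fun_of_matrix (- _) 0 0]mxE ![fun_of_matrix (_ + _) 0 0]mxE.
rewrite !negE in EE.
have Qa := proj2 pQ a; have Qb := proj2 pQ b.
have La := pL a; have Lb := pL b; have KLa := pKL a; have KLb := pKL b.
have zero (v : 'cV[R]_n) : (v^T *m (L^T *m Rm *m L) *m v) 0 0 <= 0 ->
    (v^T *m ((K - L)^T *m Rm *m (K - L)) *m v) 0 0 <= 0 ->
    (F - B *m K) *m v = (F - B *m L) *m v.
  move=> /(posdef_form0 pR) Lv /(posdef_form0 pR) KLv.
  have Kv : K *m v = 0 by rewrite -[K](subrK L) mulmxDl KLv Lv addr0.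
  by rewrite !mulmxBl -!mulmxA Kv Lv.
have Za : (F - B *m K) *m a = (F - B *m L) *m a by apply: zero; lra.
have Zb : (F - B *m K) *m b = (F - B *m L) *m b by apply: zero; lra.
move: Ma Mb; rewrite -Za -Zb.
move=> Ma Mb; have := proj1 (hurwitzP _) hK _ _ _ _ ab Ma Mb.
by rewrite ltNge al0.
Qed.

(** The right-hand side is minus a square, so [X - Y] is positive semidefinite whenever [F - B *m K]
    is Hurwitz. *)
Lemma lyap_gap (X Y : 'M[R]_n) (K : 'M[R]_(m, n)) : Y^T = Y ->
  lyap F Y - (gain Y)^T *m Rm *m gain Y + Q = 0 ->
  lyap (F - B *m K) X = - (Q + K^T *m Rm *m K) ->
  lyap (F - B *m K) (X - Y) = - ((K - gain Y)^T *m Rm *m (K - gain Y)).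
Proof.
move=> sY AY LX; rewrite lyapB LX (lyap_gain K sY) quadB.
move/eqP: AY; rewrite addr_eq0 subr_eq => /eqP ->.
set L := gain Y; move: (K^T *m _ *m K) (K^T *m _ *m L) (L^T *m _ *m K) (L^T *m _ *m L).
by move=> p q r s; apply/matrixP => i j; rewrite !mxE; ring.
Qed.

(** Entrywise convergence, for which sums and products reduce to scalar limits; [mcvgP] returns to
    the matrix topology. *)
Definition mcvg p q (u : nat -> 'M[R]_(p, q)) (l : 'M[R]_(p, q)) :=
  forall i j, (fun k => u k i j) @ \oo --> l i j.

Lemma mcvg_cst p q (l : 'M[R]_(p, q)) : mcvg (fun=> l) l.
Proof. by move=> i j; exact: cvg_cst. Qed.

Lemma mcvgD p q (u v : nat -> 'M[R]_(p, q)) l k :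
  mcvg u l -> mcvg v k -> mcvg (fun N => u N + v N) (l + k).
Proof.
move=> ul vk i j; rewrite mxE.
under eq_fun do rewrite mxE.
exact: cvgD.
Qed.

Lemma mcvgN p q (u : nat -> 'M[R]_(p, q)) l :
  mcvg u l -> mcvg (fun N => - u N) (- l).
Proof.
move=> ul i j; rewrite mxE.
under eq_fun do rewrite mxE.
exact: cvgN.
Qed.

Lemma mcvgT p q (u : nat -> 'M[R]_(p, q)) l :
  mcvg u l -> mcvg (fun N => (u N)^T) l^T.
Proof.
by move=> ul i j; rewrite mxE; under eq_fun do rewrite mxE; exact: ul.
Qed.

Lemma mcvgM p q r (u : nat -> 'M[R]_(p, q)) (v : nat -> 'M[R]_(q, r)) l k :
  mcvg u l -> mcvg v k -> mcvg (fun N => u N *m v N) (l *m k).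
Proof.
move=> ul vk i j; rewrite mxE.
under eq_fun do rewrite mxE.
apply: cvg_big => [|t _]; first by move=> z; apply: cvgD; [exact: cvg_fst|exact: cvg_snd].
by apply: cvgM; [exact: ul|exact: vk].
Qed.

Lemma mcvg_uniq p q (u : nat -> 'M[R]_(p, q)) l k :
  mcvg u l -> mcvg u k -> l = k.
Proof. by move=> ul uk; apply/matrixP => i j; exact: cvg_unique (ul i j) (uk i j). Qed.

Lemma mcvgP p q (u : nat -> 'M[R]_(p, q)) l : mcvg u l -> u @ \oo --> l.
Proof.
move=> ul; apply/cvg_ballP => e e0.
have H (ij : 'I_p * 'I_q) : \forall N \near \oo, ball (l ij.1 ij.2) e (u N ij.1 ij.2).
  by move: e e0; apply/cvg_ballP; exact: ul.
apply: filterS (filter_forall _ H) => N HN.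
by split=> // i j; exact: (HN (i, j)).
Qed.

Lemma mcvg_shift p q (u : nat -> 'M[R]_(p, q)) l N0 :
  mcvg (fun N => u (N + N0)%N) l -> mcvg u l.
Proof. by move=> ul i j; rewrite -(cvg_shiftn N0); exact: ul. Qed.

(** At each fixed vector the quadratic forms are nonincreasing and bounded below by 0, hence
    converge; polarisation then gives convergence of every entry. *)
Lemma psd_monotone_cvg (D : nat -> 'M[R]_n) :
  (forall k, possemidef (D k)) -> (forall k, possemidef (D k - D k.+1)) ->
  exists2 D0, possemidef D0 & mcvg D D0.
Proof.
move=> pD dD.
have formc (v : 'cV[R]_n) : exists2 l : R, 0 <= l &
    (fun k => (v^T *m D k *m v) 0 0) @ \oo --> l.
  have ge0 k : 0 <= (v^T *m D k *m v) 0 0 by exact: (proj2 (pD k)).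
  have cv : cvg ((fun k => (v^T *m D k *m v) 0 0) @ \oo).
    apply: nonincreasing_is_cvgn.
      apply/nonincreasing_seqP => k; have := proj2 (dD k) v.
      by rewrite mulmxBr mulmxBl !mxE subr_ge0.
    by exists 0 => _ [k _ <-].
  by eexists; last exact: cv; apply: limr_ge => //; near=> k; exact: ge0.
have [l l0 lP] : exists2 l : 'cV[R]_n -> R, (forall v, 0 <= l v) &
    forall v, (fun k => (v^T *m D k *m v) 0 0) @ \oo --> l v.
  have /choice[l lP] : forall v : 'cV[R]_n, exists l : R, 0 <= l /\
      (fun k => (v^T *m D k *m v) 0 0) @ \oo --> l.
    by move=> v; have [l] := formc v; exists l.
  by exists l => v; have [] := lP v.
pose e i : 'cV[R]_n := delta_mx i 0.
pose D0 : 'M[R]_n := \matrix_(i, j) ((l (e i + e j) - l (e i) - l (e j)) / 2).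
have cD : mcvg D D0.
  move=> i j; rewrite mxE.
  rewrite [X in X @ _ --> _](_ : _ = fun k =>
    (((e i + e j)^T *m D k *m (e i + e j)) 0 0
      - ((e i)^T *m D k *m e i) 0 0 - ((e j)^T *m D k *m e j) 0 0) / 2).
    by apply: cvgM; [apply: cvgB; [apply: cvgB|]|exact: cvg_cst]; exact: lP.
  apply/funext => k.
  have formE a b : ((e a)^T *m D k *m e b) 0 0 = D k a b.
    by rewrite trmx_delta -rowE -colE !mxE.
  rewrite [(_ + _)^T]linearD /= mulmxDl mulmxDr !mulmxDl.
  rewrite ![fun_of_matrix (_ + _) 0 0]mxE !formE.
  have -> : D k j i = D k i j by rewrite -[in LHS](proj1 (pD k)) mxE.
  by field.
exists D0 => //; split.
  by apply: (mcvg_uniq (mcvgT cD)); under eq_fun do rewrite (proj1 (pD _)).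
move=> v; have : mcvg (fun k => v^T *m D k *m v) (v^T *m D0 *m v).
  by apply: mcvgM; [apply: mcvgM|] => //; exact: mcvg_cst.
by move=> /(_ 0 0) cv; rewrite (cvg_unique _ cv (lP v)).
Unshelve. all: by end_near.
Qed.

Lemma gain_are (X : 'M[R]_n) : X^T = X ->
  lyap (F - B *m gain X) X = - (Q + (gain X)^T *m Rm *m gain X) <->
  lyap F X - (gain X)^T *m Rm *m gain X + Q = 0.
Proof.
move=> sX; rewrite lyap_gain //.
move: (lyap F X) ((gain X)^T *m _ *m gain X) => p q.
split=> E.
  rewrite -[RHS](subrr (- (Q + q))) -[X in _ = X - _]E.
  by apply/matrixP => i j; rewrite !mxE; ring.
apply: subr0_eq; rewrite -[RHS]E.
by apply/matrixP => i j; rewrite !mxE; ring.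
Qed.

Lemma mcvg_gain (X : nat -> 'M[R]_n) X0 : mcvg X X0 ->
  mcvg (fun k => gain (X k)) (gain X0).
Proof. by move=> cX; apply: mcvgM => //; exact: mcvg_cst. Qed.

Lemma mcvg_lyap (M X : nat -> 'M[R]_n) M0 X0 : mcvg M M0 -> mcvg X X0 ->
  mcvg (fun k => lyap (M k) (X k)) (lyap M0 X0).
Proof.
by move=> cM cX; apply: mcvgD; apply: mcvgM => //; exact: mcvgT.
Qed.

(* The errors [P k.+1 - Y] are positive semidefinite and decrease; their limit
   yields a solution of the Riccati equation above [Y], and the stabilizing
   solution [Y] is also above it. *)
Theorem kleinman (K : nat -> 'M[R]_(m, n)) (P : nat -> 'M[R]_n) (Y : 'M[R]_n) :
  hurwitz (F - B *m K 0%N) ->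
  (forall k, hurwitz (F - B *m K k) -> (P k.+1)^T = P k.+1 /\
    lyap (F - B *m K k) (P k.+1) = - (Q + (K k)^T *m Rm *m K k)) ->
  (forall k, hurwitz (F - B *m K k) -> K k.+1 = gain (P k.+1)) ->
  Y^T = Y -> lyap F Y - (gain Y)^T *m Rm *m gain Y + Q = 0 ->
  hurwitz (F - B *m gain Y) ->
  K @ \oo --> gain Y.
Proof.
move=> hK0 hP hKP sY AY hY.
(* The equations of a step are assumed only where the loop is already stable, so stability has to be
   propagated by induction before they hold for all [k]. *)
have hK k : hurwitz (F - B *m K k).
  elim: k => [|k IH]; first exact: hK0.
  have [sP LP] := hP k IH.
  rewrite (hKP k IH).
  exact: (hurwitz_improve IH sP LP).
have sP k : (P k.+1)^T = P k.+1 by case: (hP k (hK k)).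
have LP k : lyap (F - B *m K k) (P k.+1) = - (Q + (K k)^T *m Rm *m K k).
  by case: (hP k (hK k)).
have KP k : K k.+1 = gain (P k.+1) by exact: (hKP k (hK k)).
have sDY k : (P k.+1 - Y)^T = P k.+1 - Y by rewrite linearB /= sP sY.
have [D0 pD0 cD] : exists2 D0, possemidef D0 & mcvg (fun k => P k.+1 - Y) D0.
  apply: psd_monotone_cvg => k.
    apply: lyap_psd (hK k) (sDY k) (lyap_gap sY AY (LP k)) _.
    exact/psd_congr/posdefW.
  (* The difference of successive iterates solves a Lyapunov equation in the newer loop, whose
     right-hand side is the surplus square of [lyap_improve]. *)
  rewrite opprB addrA subrK; apply: lyap_psd (hK k.+1) _ _ _.
  - by rewrite linearB /= !sP.
  - rewrite lyapB LP KP (lyap_improve (sP k) (LP k)).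
    rewrite opprK opprD addrAC addNr add0r; reflexivity.
  - exact/psd_congr/posdefW.
pose X := D0 + Y.
have cX : mcvg (fun k => P k.+1) X.
  have := mcvgD cD (@mcvg_cst n n Y); congr (mcvg _ _).
  by apply/funext => k; rewrite subrK.
have sX : X^T = X by rewrite /X linearD /= sY (proj1 pD0).
have LX : lyap (F - B *m gain X) X = - (Q + (gain X)^T *m Rm *m gain X).
  have cg := mcvg_gain cX.
  have cl : mcvg (fun k => lyap (F - B *m gain (P k.+1)) (P k.+2))
      (lyap (F - B *m gain X) X).
    apply: mcvg_lyap; last first.
      by move=> i j; have := cX i j; rewrite -(cvg_shiftS (fun k => P k.+1 i j)).
    apply: mcvgD; first exact: mcvg_cst.
    by apply: mcvgN; apply: mcvgM => //; exact: mcvg_cst.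
  apply: (mcvg_uniq cl).
  under eq_fun do rewrite -KP LP KP.
  apply: mcvgN; apply: mcvgD; first exact: mcvg_cst.
  by apply: mcvgM => //; apply: mcvgM; [exact: mcvgT|exact: mcvg_cst].
(* [lyap_gap] with the roles exchanged: [Y] solves the Lyapunov equation of its own loop, and [X] is
   the Riccati solution with which it is compared. *)
have D00 : D0 = 0.
  apply: psd_antisym => //; have -> : - D0 = Y - X by rewrite /X opprD addrCA subrr addr0.
  apply: lyap_psd hY _ (lyap_gap sX _ _) _.
  - by rewrite linearB /= sX sY.
  - exact/gain_are.
  - exact/gain_are.
  - exact/psd_congr/posdefW.
(* The shift skips [K 0], an arbitrary stabilizing gain that need not be the gain of an iterate. *)
apply: mcvgP; apply: (@mcvg_shift _ _ _ _ 1).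
under eq_fun do rewrite addn1 KP.
have -> : Y = X by rewrite /X D00 add0r.
exact: mcvg_gain.
Qed.

End Kleinman.

(** * The data equations *)

Section DataEquations.
Variable R : realType.

Lemma sum_mxtens p q (f : 'I_p * 'I_q -> R) :
  \sum_(k < p * q) f (mxtens_unindex k) = \sum_i \sum_j f (i, j).
Proof.
rewrite pair_bigA /= [RHS](reindex (@mxtens_unindex p q)).
  by apply: eq_bigr => k _; rewrite -surjective_pairing.
exists (@mxtens_index p q) => k _; [exact: mxtens_unindexK|exact: mxtens_indexK].
Qed.

(** Row stacking against column stacking is the trace pairing, which turns the data equations into
    identities between traces. *)
Lemma row_vec_trace p q (r : 'rV[R]_(p * q)) (a : 'M[R]_(p, q)) (N : 'M[R]_(q, p)) :
  (forall k, r 0 k = a (mxtens_unindex k).1 (mxtens_unindex k).2) ->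
  (r *m vec N) 0 0 = \tr (a *m N).
Proof.
move=> rE; rewrite mxE /mxtrace.
under eq_bigr => k _ do rewrite rE mxE.
rewrite (sum_mxtens (fun k => a k.1 k.2 * N k.2 k.1)) /=.
by apply: eq_bigr => i _; rewrite mxE.
Qed.

Lemma tens_vec n m (K : 'M[R]_(m, n)) (L : 'M[R]_(m, n)) :
  (1%:M *t K^T) *m vec L = vec (K^T *m L).
Proof.
apply/colP => k; rewrite !mxE.
under eq_bigr => l _ do rewrite !mxE.
rewrite (sum_mxtens (fun l => ((mxtens_unindex k).1 == l.1)%:R
   * K l.2 (mxtens_unindex k).2 * L l.2 l.1)) /=.
rewrite (bigD1 (mxtens_unindex k).1) //= [X in _ + X]big1 ?addr0; last first.
  move=> i ik; rewrite big1 // => j _.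
  by rewrite eq_sym (negbTE ik) !mul0r.
by apply: eq_bigr => i _; rewrite eqxx mul1r !mxE.
Qed.

(** The transpose of the duplication matrix. On [vec S] it adds the two copies of an off-diagonal
    entry, whence the factor 2 in [vecs]; on a row indexed by [upper_pairs] it spreads each entry to
    both positions. The disjunction counts a diagonal entry once. *)
Definition sym_dup n : 'M[R]_((n * n.+1)./2, n * n) :=
  \matrix_(k, l) ((tnth (upper_pairs n) k == ((mxtens_unindex l).1, (mxtens_unindex l).2))
     || (tnth (upper_pairs n) k == ((mxtens_unindex l).2, (mxtens_unindex l).1)))%:R.

Lemma sym_dup_vec n (S : 'M[R]_n) : S^T = S -> sym_dup n *m vec S = vecs S.
Proof.
move=> sS; apply/colP => k; rewrite !mxE.
under eq_bigr => l _ do rewrite !mxE.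
case: (tnth _ k) => i j.
rewrite (sum_mxtens (fun l => (((i, j) == (l.1, l.2)) || ((i, j) == (l.2, l.1)))%:R
   * S l.2 l.1)) /=.
have Sji : S j i = S i j by rewrite -[in LHS]sS mxE.
rewrite (bigD1 i) //= (bigD1 j) //= eqxx /= mul1r.
rewrite [X in _ + X + _]big1 ?addr0; last first.
  move=> j' jj; rewrite !xpair_eqE eqxx /= [j == j']eq_sym (negbTE jj) /=.
  have [ij|_] := eqVneq i j'; last by rewrite mul0r.
  by rewrite ij eq_sym (negbTE jj) mul0r.
case: eqP => [->|/eqP ij].
  rewrite big1 ?addr0 // => i' ii; rewrite big1 // => j' _.
  rewrite !xpair_eqE [j == i']eq_sym (negbTE ii) /= andbF.
  by rewrite mul0r.
rewrite (bigD1 j) 1?eq_sym //= (bigD1 i) //= eqxx orbT mul1r.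
rewrite [X in _ + (_ + X + _)]big1 ?addr0; last first.
  move=> j' jj; rewrite !xpair_eqE [i == j']eq_sym (negbTE jj) (negbTE ij) /=.
  by rewrite mul0r.
rewrite big1 ?addr0; first by rewrite Sji mulr_natl mulr2n.
move=> i' /andP[ii ij']; rewrite big1 // => j' _.
by rewrite !xpair_eqE [i == i']eq_sym [j == i']eq_sym (negbTE ii) (negbTE ij') /= andbF mul0r.
Qed.

Lemma upper_seq_uniq n : uniq (upper_seq n).
Proof.
apply: allpairs_uniq_dep => [||[i j] [i' j'] _ _ /= [-> ->] //].
  exact: enum_uniq.
by move=> i _; rewrite filter_uniq // enum_uniq.
Qed.

Lemma mem_upper_seq n (i j : 'I_n) : ((i, j) \in upper_seq n) = (i <= j)%N.
Proof.
apply/allpairsPdep/idP => [[i' [j' [_ +]]]|ij].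
  by rewrite mem_filter => /andP[ij _] [-> ->].
exists i, j; split; first exact: mem_enum.
  by rewrite mem_filter ij; exact: mem_enum.
by [].
Qed.

(** Only one ordering of each index pair occurs in [upper_pairs], so a single term of the sum
    survives. *)
Lemma row_sym_dup n (a : 'M[R]_n) (l : 'I_(n * n)) : a^T = a ->
  \sum_k a (tnth (upper_pairs n) k).1 (tnth (upper_pairs n) k).2 * sym_dup n k l
  = a (mxtens_unindex l).1 (mxtens_unindex l).2.
Proof.
move=> sa; under eq_bigr => k _ do rewrite mxE.
case: (mxtens_unindex l) => i j /=.
rewrite -(big_tuple _ _ (upper_pairs n) xpredT
   (fun p => a p.1 p.2 * ((p == (i, j)) || (p == (j, i)))%:R)) /=.
have aji : a j i = a i j by rewrite -[in LHS]sa mxE.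
have aux (i' j' : 'I_n) : (i' <= j')%N ->
  \sum_(p <- upper_seq n) a p.1 p.2 * ((p == (i', j')) || (p == (j', i')))%:R = a i' j'.
  move=> ij; rewrite (bigD1_seq (i', j')) ?upper_seq_uniq ?mem_upper_seq //=.
  rewrite eqxx mulr1 big1_seq ?addr0 // => -[u v] /andP[uv].
  rewrite mem_upper_seq => luv; rewrite (negbTE uv) /=.
  case: eqP => [[eu ev]|]; last by rewrite mulr0.
  have e : i' = j' by apply/val_inj/eqP; rewrite eqn_leq ij -eu -ev luv.
  by rewrite eu ev e eqxx in uv.
have [ij|/ltnW ji] := leqP i j; first exact: aux.
by under eq_bigr do rewrite orbC; rewrite aux.
Qed.

Lemma vecs_inj0 n (S : 'M[R]_n) : S^T = S -> vecs S = 0 -> S = 0.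
Proof.
move=> sS vS.
have aux (i j : 'I_n) : (i <= j)%N -> S i j = 0.
  rewrite -mem_upper_seq => /(nthP (i, j))[k].
  rewrite (eqP (size_upper_seq n)) => kn kE.
  have tE : tnth (upper_pairs n) (Ordinal kn) = (i, j).
    by rewrite (tnth_nth (i, j)) /= kE.
  move/colP: vS => /(_ (Ordinal kn)); rewrite !mxE tE; case: eqP => // _ /eqP.
  by rewrite mulf_eq0 pnatr_eq0 /= => /eqP.
apply/matrixP => i j; rewrite [RHS]mxE.
have [ij|/ltnW ji] := leqP i j; first exact: aux.
by rewrite -sS mxE aux.
Qed.

Lemma vec_inj0 m n (N : 'M[R]_(m, n)) : vec N = 0 -> N = 0.
Proof.
move=> vN; apply/matrixP => i j; rewrite [RHS]mxE.
by move/colP: vN => /(_ (mxtens_index (j, i))); rewrite !mxE mxtens_indexK.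
Qed.

(** [D'] has [r] columns and rank at least that of [D], so it has full column rank and cancels on
    the left. *)
Lemma full_rank_factor (p q r : nat) (D : 'M[R]_(p, q)) (D' : 'M[R]_(p, r))
  (E : 'M[R]_(r, q)) (z : 'cV[R]_q) :
  D = D' *m E -> \rank D = r -> D *m z = 0 -> E *m z = 0.
Proof.
move=> DE rD Dz; have rDD' : (\rank D <= \rank D')%N by rewrite DE mxrankM_maxl.
have fD' : row_free D'^T.
  by rewrite /row_free mxrank_tr eqn_leq rank_leq_col /= -{1}rD.
apply: trmx_inj; apply: (row_free_inj fD').
by rewrite -trmx_mul mulmxA -DE Dz !trmx0 mul0mx.
Qed.

Section DataMatrices.
Variables (n m : nat) (A : 'M[R]_n) (B : 'M[R]_(n, m)) (rho : R).
Variables (X : R -> 'cV[R]_n) (V : R -> 'cV[R]_m) (s : nat -> R) (d : nat).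

Definition momentXX a b : 'M[R]_n :=
  mxint a b (fun t => expR (- (rho * t)) *: (X t *m (X t)^T)).
Definition momentXV a b : 'M[R]_(n, m) :=
  mxint a b (fun t => expR (- (rho * t)) *: (X t *m (V t)^T)).
Definition disc_gram t : 'M[R]_n := expR (- (rho * t)) *: (X t *m (X t)^T).

Lemma momentXX_sym a b : (momentXX a b)^T = momentXX a b.
Proof.
apply/matrixP => i j; rewrite !mxE; congr Rintegral; apply/funext => t.
by rewrite !mxE !big_ord1 !mxE [X _ j _ * _]mulrC.
Qed.

Lemma data_IX_entry j k : data_IX rho X s d j k =
  momentXX (s j) (s j.+1) (mxtens_unindex k).1 (mxtens_unindex k).2.
Proof.
rewrite !mxE; congr Rintegral; apply/funext => t.
by rewrite !mxE big_ord1 !mxE !ord1.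
Qed.

Lemma data_IXV_entry j k : data_IXV rho X V s d j k =
  momentXV (s j) (s j.+1) (mxtens_unindex k).1 (mxtens_unindex k).2.
Proof.
rewrite !mxE; congr Rintegral; apply/funext => t.
by rewrite !mxE big_ord1 !mxE !ord1.
Qed.

Lemma data_IX_vec (M : 'M[R]_n) j :
  (data_IX rho X s d *m vec M) j 0 = \tr (momentXX (s j) (s j.+1) *m M).
Proof.
have <- := @row_vec_trace _ _ (row j (data_IX rho X s d)) (momentXX (s j) (s j.+1)) M.
  by rewrite -row_mul [RHS]mxE.
by move=> k; rewrite mxE data_IX_entry.
Qed.

Lemma data_IXV_vec (N : 'M[R]_(m, n)) j :
  (data_IXV rho X V s d *m vec N) j 0 = \tr (momentXV (s j) (s j.+1) *m N).
Proof.
have <- := @row_vec_trace _ _ (row j (data_IXV rho X V s d)) (momentXV (s j) (s j.+1)) N.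
  by rewrite -row_mul [RHS]mxE.
by move=> k; rewrite mxE data_IXV_entry.
Qed.

Lemma quadmon_sym_dup (z : 'cV[R]_n) k :
  ((quadmon z)^T *m sym_dup n) 0 k =
  (z *m z^T) (mxtens_unindex k).1 (mxtens_unindex k).2.
Proof.
rewrite -row_sym_dup; last by rewrite trmx_mul trmxK.
rewrite mxE; apply: eq_bigr => l _; rewrite !mxE; case: (tnth _ l) => i j.
by rewrite big_ord1 mxE.
Qed.

Lemma quadmon_vecs (z : 'cV[R]_n) (P : 'M[R]_n) : P^T = P ->
  ((quadmon z)^T *m vecs P) 0 0 = \tr (z *m z^T *m P).
Proof.
move=> sP; rewrite -(sym_dup_vec sP) mulmxA.
by apply: row_vec_trace => k; exact: quadmon_sym_dup.
Qed.

Lemma data_I_vecs (P : 'M[R]_n) j : P^T = P ->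
  (data_I rho X s d *m vecs P) j 0 =
  \tr ((disc_gram (s j.+1) - disc_gram (s j)) *m P).
Proof.
move=> sP.
have -> : (data_I rho X s d *m vecs P) j 0 =
    (row j (data_I rho X s d) *m vecs P) 0 0 by rewrite -row_mul [RHS]mxE.
have -> : row j (data_I rho X s d) = data_phi rho X (s j) (s j.+1).
  by apply/rowP => k; rewrite !mxE.
rewrite /data_phi mulmxBl -!scalemxAl mulmxBl raddfB /= /disc_gram.
rewrite -!scalemxAl !linearZ /= -!quadmon_vecs //.
by rewrite !mxE.
Qed.

(** Symmetry of the moments lets [data_IX] factor through [sym_dup], which leaves a matrix with
    exactly as many columns as the assumed rank, hence an injective one; a symmetric [S] is then
    determined by [vecs S]. *)
Lemma data_full_rank :
  \rank (row_mx (data_IX rho X s d) (data_IXV rho X V s d))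
    = (m * n + (n * n.+1)./2)%N ->
  forall (S : 'M[R]_n) (N : 'M[R]_(m, n)), S^T = S ->
  (forall j : 'I_d, \tr (momentXX (s j) (s j.+1) *m S) +
      \tr (momentXV (s j) (s j.+1) *m N) = 0) ->
  S = 0 /\ N = 0.
Proof.
move=> rD S N sS SN.
pose J : 'M[R]_(d, (n * n.+1)./2) := \matrix_(j, k)
  momentXX (s j) (s j.+1) (tnth (upper_pairs n) k).1 (tnth (upper_pairs n) k).2.
pose W := block_mx (sym_dup n) 0 0 1%:M : 'M[R]_((n * n.+1)./2 + n * m, _).
have DE : row_mx (data_IX rho X s d) (data_IXV rho X V s d) =
    row_mx J (data_IXV rho X V s d) *m W.
  rewrite mul_row_block !mulmx0 addr0 add0r mulmx1; congr row_mx.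
  apply/matrixP => j k; rewrite data_IX_entry -row_sym_dup ?momentXX_sym // [RHS]mxE.
  by apply: eq_bigr => l _; rewrite [J _ _]mxE.
rewrite [RHS]addnC (mulnC m) in rD.
have := @full_rank_factor _ _ _ _ _ _ (col_mx (vec S) (vec N)) DE rD.
rewrite mul_row_col mul_block_col !mul0mx addr0 add0r mul1mx sym_dup_vec //.
move=> /(_ _)/eqP; rewrite col_mx_eq0 => H.
have /andP[/eqP /(vecs_inj0 sS) -> /eqP /vec_inj0 -> //] : (vecs S == 0) && (vec N == 0).
apply: H; apply/colP => j; rewrite mxE data_IX_vec data_IXV_vec SN mxE; reflexivity.
Qed.

Hypothesis dataE : forall j : nat, disc_gram (s j.+1) - disc_gram (s j) =
  - rho *: momentXX (s j) (s j.+1)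
  + (A *m momentXX (s j) (s j.+1) + momentXX (s j) (s j.+1) *m A^T)
  + (B *m (momentXV (s j) (s j.+1))^T + momentXV (s j) (s j.+1) *m B^T).

(** Half of the discount on each side: P F + F^T P = P A + A^T P - rho P. *)
Let F := A - (rho / 2)%:M.

(** The residual of a data equation pairs the two moments with the residuals of the Lyapunov
    equation and of [L = B^T *m P]. The factors 2 come from merging mutually transposed terms under
    the trace. *)
Lemma data_Delta_vec (K L : 'M[R]_(m, n)) (P M : 'M[R]_n) (j : 'I_d) :
  P^T = P -> M^T = M ->
  (data_Delta rho X V s d K *m col_mx (vecs P) (vec L)
     - data_IX rho X s d *m vec M) j 0 =
  \tr (momentXX (s j) (s j.+1) *m
    (P *m F + F^T *m P - K^T *m L - L^T *m K - M)) +
  \tr (momentXV (s j) (s j.+1) *m (2 *: (B^T *m P - L))).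
Proof.
move=> sP sM.
rewrite /data_Delta mul_row_col mulmxBl mulNmx -!scalemxAl -mulmxA tens_vec.
have E4 (p q r t : 'cV[R]_d) : (p + (- (2 *: q) - 2 *: r) - t) j 0 =
    p j 0 - 2 * q j 0 - 2 * r j 0 - t j 0.
  by rewrite !mxE !addrA.
rewrite E4 !data_IX_vec data_IXV_vec data_I_vecs // dataE.
have := momentXX_sym (s j) (s j.+1).
move: (momentXX _ _) (momentXV _ _) => a b sa.
have trB (p q : 'M[R]_n) : \tr (p - q) = \tr p - \tr q by rewrite raddfB.
have R1 : \tr ((- rho *: a + (A *m a + a *m A^T) + (B *m b^T + b *m B^T)) *m P) =
    - rho * \tr (a *m P) + \tr (a *m (P *m A)) + \tr (a *m (A^T *m P))
    + 2 * \tr (b *m (B^T *m P)).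
  rewrite !mulmxDl !mxtraceD -scalemxAl mxtraceZ.
  have -> : \tr (A *m a *m P) = \tr (a *m (P *m A)).
    by rewrite -mulmxA mxtrace_mulC -mulmxA.
  have -> : \tr (B *m b^T *m P) = \tr (b *m (B^T *m P)).
    by rewrite -mxtrace_tr !trmx_mul trmxK sP mxtrace_mulC mulmxA.
  by rewrite -!mulmxA; ring.
have R2 : \tr (a *m (P *m F + F^T *m P - K^T *m L - L^T *m K - M)) =
    \tr (a *m (P *m A)) + \tr (a *m (A^T *m P)) - rho * \tr (a *m P)
    - 2 * \tr (a *m (K^T *m L)) - \tr (a *m M).
  have -> : P *m F + F^T *m P = P *m A + A^T *m P - rho *: P.
    rewrite /F [(A - _)^T]linearB /= tr_scalar_mx mulmxBr mulmxBl.
    rewrite mul_mx_scalar mul_scalar_mx addrACA -opprD -scalerDl.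
    by rewrite -mulrDl -mulr2n -(mulr_natr rho) mulfK ?pnatr_eq0.
  rewrite !mulmxBr mulmxDr !trB mxtraceD -scalemxAr mxtraceZ.
  have -> : \tr (a *m (L^T *m K)) = \tr (a *m (K^T *m L)).
    by rewrite -mxtrace_tr !trmx_mul trmxK sa mxtrace_mulC.
  by ring.
have R3 : \tr (b *m (2 *: (B^T *m P - L))) =
    2 * \tr (b *m (B^T *m P)) - 2 * \tr (b *m L).
  by rewrite -scalemxAr mxtraceZ mulmxBr trB mulrBr.
by rewrite R1 R2 R3; ring.
Qed.

(* [data_Delta K] has full column rank, and the exact solution of the Lyapunov
   equation satisfies the overdetermined system, so the least-squares solution
   is exact. *)
Lemma pi_solve_exact (K L : 'M[R]_(m, n)) (P M : 'M[R]_n) :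
  \rank (row_mx (data_IX rho X s d) (data_IXV rho X V s d))
    = (m * n + (n * n.+1)./2)%N ->
  hurwitz (F - B *m K) -> M^T = M ->
  pi_solve rho X V s d M K P L ->
  [/\ P^T = P, lyap (F - B *m K) P = M & L = B^T *m P].
Proof.
move=> rD hK sM [sP PL].
have lyapE (P0 : 'M[R]_n) : P0^T = P0 -> lyap (F - B *m K) P0 =
    P0 *m F + F^T *m P0 - K^T *m (B^T *m P0) - (B^T *m P0)^T *m K.
  move=> sP0; rewrite /lyap [(F - _)^T]linearB /= !trmx_mul trmxK sP0.
  by rewrite mulmxBl mulmxBr !mulmxA addrACA addrA (addrC (F^T *m P0)).
(* Stability of the current loop provides a solution, which witnesses that the linear system is
   consistent. *)
have [P0 sP0 LP0] := lyapunov_solve hK sM.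
have {}LP0 : lyap (F - B *m K) P0 = M := LP0.
have ex : data_Delta rho X V s d K *m col_mx (vecs P0) (vec (B^T *m P0)) =
    data_IX rho X s d *m vec M.
  apply/colP => j; apply: subr0_eq; have := data_Delta_vec K (B^T *m P0) j sP0 sM.
  rewrite -lyapE // LP0 !subrr scaler0 !mulmx0 !raddf0 addr0.
  by rewrite [LHS]mxE [X in _ + X]mxE.
(* On a consistent system the pseudoinverse gives an exact solution, by the first Penrose
   identity. *)
have sol : data_Delta rho X V s d K *m col_mx (vecs P) (vec L) =
    data_IX rho X s d *m vec M.
  rewrite PL -ex !mulmxA.
  by have [-> _ _ _] := pinvP (data_Delta rho X V s d K).
(* The residual of the computed [P] and [L]; its symmetry is what gives access to the rank
   condition. *)
pose S := P *m F + F^T *m P - K^T *m L - L^T *m K - M.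
have sS : S^T = S.
  have TB (p q : 'M[R]_n) : (p - q)^T = p^T - q^T by exact: linearB.
  have TD (p q : 'M[R]_n) : (p + q)^T = p^T + q^T by exact: linearD.
  rewrite /S 3!TB TD !trmx_mul !trmxK sP sM (addrC (F^T *m P)).
  by congr (_ - _); rewrite addrAC.
have [S0 /eqP] : S = 0 /\ 2 *: (B^T *m P - L) = 0.
  apply: (data_full_rank rD sS) => j; rewrite -data_Delta_vec // sol.
  by rewrite subrr mxE.
rewrite scaler_eq0 pnatr_eq0 /= subr_eq0 => /eqP EL.
split=> //; rewrite lyapE // EL; exact: subr0_eq.
Qed.

End DataMatrices.
End DataEquations.

(** * Absolutely continuous functions *)

Section RealFubini.
Context {R : realType}.

(** Iterated integrals are extended-real and finite only almost everywhere; [fine] makes them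
    real-valued without changing their integral. *)
Lemma integrable_fine d (T : measurableType d) (m : {measure set T -> \bar R})
    (D : set T) (F : T -> \bar R) : measurable D -> m.-integrable D F ->
  m.-integrable D (EFin \o (fine \o F)) /\
  (\int[m]_(x in D) (fine (F x))%:E = \int[m]_(x in D) F x)%E.
Proof.
move=> mD iF.
pose G : T -> R := fine \o F.
have mfF : measurable_fun D (EFin \o G : T -> \bar R).
  apply/measurable_EFinP; apply: measurableT_comp => //.
  exact: (measurable_int m).
have aeE : ae_eq m D (EFin \o G) F.
  have := integrable_ae mD iF; apply: filterS => x h Dx /=.
  by rewrite fineK // h.
split.
  apply: (le_integrable mD mfF _ iF) => x Dx /=.
  by rewrite /G /=; case: (F x) => [r| |] /=; rewrite ?normr0 ?leey.
apply: (@ae_eq_integral _ _ _ m D F (EFin \o G)) => //.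
exact: (measurable_int m iF).
Qed.

Lemma integrable_fubini_snd d1 d2 (T1 : measurableType d1)
    (T2 : measurableType d2) (m1 : {sigma_finite_measure set T1 -> \bar R})
    (m2 : {sigma_finite_measure set T2 -> \bar R}) (f : T1 * T2 -> \bar R) :
  (m1 \x m2)%E.-integrable setT f ->
  m2.-integrable setT (fun y => \int[m1]_x f (x, y))%E.
Proof.
move=> imf; have mf := measurable_int _ imf.
apply/integrableP; split; first exact: (measurable_fubini_G imf).
apply: le_lt_trans ((integrable21ltyP m1 m2 mf).1 imf).
apply: ge0_le_integral => //.
- by apply: measurableT_comp => //; exact: (measurable_fubini_G imf).
- apply: (measurable_fun_fubini_tonelli_G (abse \o f)) => //=.
  exact: measurableT_comp.
- move=> y _; apply: le_abse_integral => //.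
  by apply: measurableT_comp mf _; exact: pair2_measurable.
Qed.

Lemma fubini_real d1 d2 (T1 : measurableType d1) (T2 : measurableType d2)
    (m1 : {sigma_finite_measure set T1 -> \bar R})
    (m2 : {sigma_finite_measure set T2 -> \bar R}) (f : T1 * T2 -> R) :
  (m1 \x m2)%E.-integrable setT (EFin \o f) ->
  [/\ m1.-integrable setT (EFin \o (fun x => \int[m2]_y f (x, y))),
      m2.-integrable setT (EFin \o (fun y => \int[m1]_x f (x, y))) &
      \int[m1]_x \int[m2]_y f (x, y) = \int[m2]_y \int[m1]_x f (x, y)].
Proof.
move=> imf.
have [i1 e1] := integrable_fine measurableT (integrable_fubini_F imf).
have [i2 e2] := integrable_fine measurableT (integrable_fubini_snd imf).
split; [exact: i1|exact: i2|].
by congr fine; rewrite [LHS]e1 [RHS]e2; exact: (Fubini imf).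
Qed.

Notation mu := (@lebesgue_measure R).

Lemma integrable_tensor (f g : R -> R) :
  mu.-integrable setT (EFin \o f) -> mu.-integrable setT (EFin \o g) ->
  (mu \x mu)%E.-integrable setT (EFin \o (fun z : R * R => f z.1 * g z.2)).
Proof.
move=> iF iG.
have mF : measurable_fun setT f by apply/measurable_EFinP; exact: (measurable_int mu).
have mG : measurable_fun setT g by apply/measurable_EFinP; exact: (measurable_int mu).
apply/integrable12ltyP.
  apply/measurable_EFinP; apply: measurable_funM => //.
    by apply: measurableT_comp mF _.
  by apply: measurableT_comp mG _.
move/integrableP : iF => [_ iF]; move/integrableP : iG => [_ iG].
under eq_integral => x _.
  under eq_integral => y _ do rewrite /= normrM EFinM.
  rewrite ge0_integralZl_EFin //; first over.
    by apply/measurable_EFinP/measurableT_comp.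
have c0 : (0 <= \int[mu]_y `|(EFin \o g) y|)%E by apply: integral_ge0.
rewrite ge0_integralZr //; last by apply/measurable_EFinP/measurableT_comp.
apply: lte_mul_pinfty => //; first exact: integral_ge0.
by rewrite ge0_fin_numE ?integral_ge0.
Qed.

Lemma Rintegral_indic_scale (D : set (measurableTypeR R)) (c : R) (g : R -> R) :
  measurable D -> mu.-integrable setT (EFin \o g) ->
  \int[mu]_s (c * g s * \1_D s) = c * \int[mu]_(s in D) g s.
Proof.
move=> mD iG; rewrite [in RHS]Rintegral_mkcond -RintegralZl //.
  apply: eq_Rintegral => s _; rewrite patchE indicE.
  by case: (s \in D); rewrite ?mulr1 ?mulr0.
rewrite -restrict_EFin; apply: (integrable_mkcond _ mD).1.
exact: (integrableS measurableT mD (@subsetT _ _) iG).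
Qed.

Lemma integrable_indicM d (T : measurableType d) (m : {measure set T -> \bar R})
    (D : set T) (f : T -> R) : measurable D -> m.-integrable setT (EFin \o f) ->
  m.-integrable setT (EFin \o (fun x => f x * \1_D x)).
Proof.
move=> mD iF.
have mF : measurable_fun setT f by apply/measurable_EFinP; exact: (measurable_int m).
apply: (le_integrable measurableT _ _ iF).
  by apply/measurable_EFinP; apply: measurable_funM => //; exact: measurable_indic.
move=> x _ /=; rewrite lee_fin normrM indicE.
by case: (x \in D); rewrite ?normr1 ?normr0 ?mulr1 ?mulr0.
Qed.

Lemma Rintegral_split_line (t : R) (g : R -> R) :
  mu.-integrable setT (EFin \o g) ->
  \int[mu]_(s in `]-oo, t]) g s + \int[mu]_(s in `[t, +oo[) g s = \int[mu]_s g s.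
Proof.
move=> iG.
have iD (D : set (measurableTypeR R)) : measurable D -> mu.-integrable D (EFin \o g).
  by move=> mD; exact: (integrableS measurableT mD (@subsetT _ _) iG).
rewrite -Rintegral_itv_obnd_cbnd; last exact: iD.
rewrite -Rintegral_setU //; last 2 first.
- by apply: iD; exact: measurableU.
- apply/disj_setPRL => x /=; rewrite !in_itv /= andbT => tx.
  by apply/negP; rewrite -ltNge.
by congr Rintegral; apply/seteqP; split=> // x _ /=; rewrite !in_itv /= andbT;
  case: (leP x t); [left|right].
Qed.

Lemma measurable_le_set d (T : measurableType d) (f g : T -> R) :
  measurable_fun setT f -> measurable_fun setT g -> measurable [set z | f z <= g z].
Proof.
move=> mf mg.
have -> : [set z | f z <= g z] = setT `&` (f \- g) @^-1` `]-oo, 0].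
  by apply/seteqP; split=> z; rewrite /= in_itv /= subr_le0 => // -[].
by apply: measurable_funB.
Qed.

Lemma indic_iff T1 T2 (D1 : set T1) (D2 : set T2) x y :
  (D1 x <-> D2 y) -> \1_D1 x = \1_D2 y :> R.
Proof.
move=> h; rewrite !indicE; have -> // : (x \in D1) = (y \in D2).
by apply/idP/idP; rewrite !inE => /h.
Qed.

(** Fubini for f(t) g(s) on the half-plane [t <= s]. The two closed half-planes cover the plane, and
    their overlap, the diagonal, meets each line [t = const] in a null set. *)
Lemma by_parts_line (f g : R -> R) :
  mu.-integrable setT (EFin \o f) -> mu.-integrable setT (EFin \o g) ->
  \int[mu]_t (f t * \int[mu]_(s in `]-oo, t]) g s) +
  \int[mu]_t ((\int[mu]_(s in `]-oo, t]) f s) * g t) =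
  (\int[mu]_t f t) * (\int[mu]_t g t).
Proof.
move=> iF iG; have iFG := integrable_tensor iF iG.
pose E1 := [set z : R * R | z.2 <= z.1]; pose E2 := [set z : R * R | z.1 <= z.2].
have mE1 : measurable E1.
  by apply: measurable_le_set.
have mE2 : measurable E2.
  by apply: measurable_le_set.
pose h1 z := f z.1 * g z.2 * \1_E1 z; pose h2 z := f z.1 * g z.2 * \1_E2 z.
have ih1 : (mu \x mu)%E.-integrable setT (EFin \o h1) by exact: integrable_indicM.
have ih2 : (mu \x mu)%E.-integrable setT (EFin \o h2) by exact: integrable_indicM.
have [i11 i12 e1] := fubini_real ih1; have [i21 i22 e2] := fubini_real ih2.
have h1E t : \int[mu]_s h1 (t, s) = f t * \int[mu]_(s in `]-oo, t]) g s.
  have <- := @Rintegral_indic_scale `]-oo, t] (f t) g (measurable_itv _) iG.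
  apply: eq_Rintegral => s _; rewrite /h1; congr (_ * _).
have h2E t : \int[mu]_s h2 (t, s) = f t * \int[mu]_(s in `[t, +oo[) g s.
  have <- := @Rintegral_indic_scale `[t, +oo[ (f t) g (measurable_itv _) iG.
  apply: eq_Rintegral => s _; rewrite /h2; congr (_ * _).
  by apply: indic_iff; rewrite /E2 /= in_itv /= andbT.
have h2E' t : \int[mu]_s h2 (s, t) = (\int[mu]_(s in `]-oo, t]) f s) * g t.
  rewrite mulrC; have <- := @Rintegral_indic_scale `]-oo, t] (g t) f (measurable_itv _) iF.
  apply: eq_Rintegral => s _; rewrite /h2 /= (mulrC (f s)); congr (_ * _).
under eq_Rintegral do rewrite -h1E.
under [X in _ + X]eq_Rintegral do rewrite -h2E'.
rewrite -e2 -(RintegralD measurableT i11 i21) -(RintegralZr _ measurableT iF).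
by apply: eq_Rintegral => t _; rewrite h1E h2E -mulrDr Rintegral_split_line.
Qed.

(* [f] is absolutely continuous on [a, b], with density [f']. *)
Definition primitive_on (a b : R) (f f' : R -> R) :=
  mu.-integrable `[a, b] (EFin \o f') /\
  forall t, a <= t <= b -> f t = f a + \int[mu]_(s in `[a, t]) f' s.

Lemma integrable_subitv (a b c d : R) (f : R -> R) : a <= c -> d <= b ->
  mu.-integrable `[a, b] (EFin \o f) -> mu.-integrable `[c, d] (EFin \o f).
Proof.
move=> ac db iF; apply: integrableS iF => // x /=; rewrite !in_itv /=.
by move=> /andP[cx xd]; rewrite (le_trans ac cx) (le_trans xd db).
Qed.

Lemma integrable_patch (a b : R) (f : R -> R) :
  mu.-integrable `[a, b] (EFin \o f) ->
  mu.-integrable setT (EFin \o (f \_ `[a, b])).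
Proof.
move=> iF; rewrite -restrict_EFin.
exact: (@integrable_mkcond _ (measurableTypeR R) _ mu `[a, b] (EFin \o f)
  (measurable_itv _)).1.
Qed.

Lemma Rintegral_patch_ray (a b t : R) (f : R -> R) : a <= t <= b ->
  \int[mu]_(s in `]-oo, t]) (f \_ `[a, b]) s = \int[mu]_(s in `[a, t]) f s.
Proof.
move=> /andP[at_ tb]; rewrite -Rintegral_mkcondr; congr Rintegral.
apply/seteqP; split=> x /=; rewrite !in_itv /=.
  by move=> [-> /andP[-> _]].
by move=> /andP[-> xt]; split=> //; rewrite (le_trans xt tb).
Qed.

Lemma by_parts_itv (a b : R) (f g : R -> R) :
  mu.-integrable `[a, b] (EFin \o f) -> mu.-integrable `[a, b] (EFin \o g) ->
  \int[mu]_(t in `[a, b]) (f t * \int[mu]_(s in `[a, t]) g s) +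
  \int[mu]_(t in `[a, b]) ((\int[mu]_(s in `[a, t]) f s) * g t) =
  (\int[mu]_(t in `[a, b]) f t) * (\int[mu]_(t in `[a, b]) g t).
Proof.
move=> /integrable_patch iF /integrable_patch iG.
have := by_parts_line iF iG; rewrite -!Rintegral_mkcond => <-.
congr (_ + _); rewrite [LHS]Rintegral_mkcond; apply: eq_Rintegral => t _.
  rewrite !patchE; case: ifPn => [|_]; last by rewrite mul0r.
  by rewrite inE /= in_itv /= => tab; rewrite Rintegral_patch_ray.
rewrite !patchE; case: ifPn => [|_]; last by rewrite mulr0.
by rewrite inE /= in_itv /= => tab; rewrite Rintegral_patch_ray.
Qed.

Lemma primitive_on_measurable (a b : R) (f f' : R -> R) : a <= b ->
  primitive_on a b f f' -> measurable_fun `[a, b] f.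
Proof.
move=> ab [iF fE].
apply: (eq_measurable_fun (fun t => f a + \int[mu]_(s in `[a, t]) f' s)).
  by move=> t; rewrite inE /= in_itv /= => /fE.
apply: measurable_funD => //.
apply: subspace_continuous_measurable_fun => //.
exact: parameterized_integral_continuous.
Qed.

Lemma primitive_on_bounded (a b : R) (f f' : R -> R) :
  primitive_on a b f f' -> [bounded f x | x in `[a, b]%classic].
Proof.
move=> [iF fE].
exists (`|f a| + \int[mu]_(s in `[a, b]) `|f' s|); split; first exact: num_real.
move=> M MB t /=; rewrite in_itv /= => tab; apply/ltW/(le_lt_trans _ MB).
rewrite fE //; apply: (le_trans (ler_normD _ _)); rewrite lerD2l.
have /andP[at_ tb] := tab; have iFt := integrable_subitv (lexx a) tb iF.
apply: (le_trans (le_normr_Rintegral _ iFt)) => //.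
rewrite [leLHS]Rintegral_mkcond [leRHS]Rintegral_mkcond.
apply: le_Rintegral => //.
- by apply: integrable_patch; exact: (integrable_norm iFt).
- by apply: integrable_patch; exact: (integrable_norm iF).
move=> x _; rewrite !patchE; case: ifPn => [|_]; last by case: ifP => _; rewrite ?normr_ge0 ?lexx.
rewrite inE /= in_itv /= => /andP[ax xt].
by rewrite mem_set //= in_itv /= ax (le_trans xt tb).
Qed.

Lemma primitive_on_mul_integrable (a b : R) (f f' g : R -> R) : a <= b ->
  primitive_on a b f f' -> mu.-integrable `[a, b] (EFin \o g) ->
  mu.-integrable `[a, b] (EFin \o (fun t => f t * g t)).
Proof.
move=> ab pf iG.
have mf := primitive_on_measurable ab pf; have bf := primitive_on_bounded pf.
exact: (@integrableMr _ (measurableTypeR R) R mu `[a, b] (measurable_itv _) f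
  (EFin \o g) mf bf iG).
Qed.

Lemma primitive_on_sub (a b c d : R) (f f' : R -> R) : a <= c -> c <= d -> d <= b ->
  primitive_on a b f f' -> primitive_on c d f f'.
Proof.
move=> ac cd db [iF fE]; split; first exact: integrable_subitv iF.
move=> t /andP[ct td].
have at_ := le_trans ac ct; have tb := le_trans td db.
have cb := le_trans cd db.
rewrite (fE t) ?at_ // (fE c) ?ac //.
have iT := integrable_subitv (lexx a) tb iF.
have := @Rintegral_itvB R f' (BLeft a) (BRight t) c iT.
rewrite !bnd_simp => /(_ ac ct) /eqP; rewrite subr_eq => /eqP ->.
rewrite Rintegral_itv_obnd_cbnd; last first.
  by apply: integrableS iT => // x /=; rewrite !in_itv /= => /andP[cx ->];
    rewrite (le_trans ac (ltW cx)).
by rewrite -addrA [X in _ + X]addrC.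
Qed.

(** With each factor written as initial value plus integral of its density, the only nonlinear term
    is a product of two integrals, which [by_parts_itv] splits. *)
Lemma primitive_on_mul (a b : R) (f f' g g' : R -> R) : a <= b ->
  primitive_on a b f f' -> primitive_on a b g g' ->
  primitive_on a b (fun t => f t * g t) (fun t => f' t * g t + f t * g' t).
Proof.
move=> ab pf pg.
have int c d (pf' : primitive_on c d f f') (pg' : primitive_on c d g g') (cd : c <= d) :
  mu.-integrable `[c, d] (EFin \o (fun t => f' t * g t)) /\
  mu.-integrable `[c, d] (EFin \o (fun t => f t * g' t)).
  split; last exact: primitive_on_mul_integrable pf' (pg'.1).
  rewrite (_ : (fun t => f' t * g t) = (fun t => g t * f' t)); last first.
    by apply/funext => t; rewrite mulrC.
  exact: primitive_on_mul_integrable pg' (pf'.1).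
split; first by have [i1 i2] := int _ _ pf pg ab; exact: integrableD i1 i2.
move=> t /andP[at_ tb].
have pf' := primitive_on_sub (lexx a) at_ tb pf.
have pg' := primitive_on_sub (lexx a) at_ tb pg.
have [i1 i2] := int _ _ pf' pg' at_.
have tt : a <= t <= t by rewrite at_ lexx.
rewrite RintegralD // (pf'.2 t tt) (pg'.2 t tt).
have iF := pf'.1; have iG := pg'.1.
have iFa : mu.-integrable `[a, t] (EFin \o (fun s => g a * f' s)).
  exact: integrableZl iF.
have iGa : mu.-integrable `[a, t] (EFin \o (fun s => f a * g' s)).
  exact: integrableZl iG.
have E1 : \int[mu]_(s in `[a, t]) (f' s * \int[mu]_(r in `[a, s]) g' r) =
    \int[mu]_(s in `[a, t]) (f' s * g s) - g a * \int[mu]_(s in `[a, t]) f' s.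
  rewrite -RintegralZl // -RintegralB //; apply: eq_Rintegral => s.
  by rewrite inE /= in_itv /= => st; rewrite (pg'.2 s st); ring.
have E2 : \int[mu]_(s in `[a, t]) ((\int[mu]_(r in `[a, s]) f' r) * g' s) =
    \int[mu]_(s in `[a, t]) (f s * g' s) - f a * \int[mu]_(s in `[a, t]) g' s.
  rewrite -RintegralZl // -RintegralB //; apply: eq_Rintegral => s.
  by rewrite inE /= in_itv /= => st; rewrite (pf'.2 s st); ring.
have := by_parts_itv iF iG; rewrite E1 E2 => E.
by rewrite mulrDl !mulrDr -E; ring.
Qed.

Lemma primitive_on_expR (a b c : R) : a <= b ->
  primitive_on a b (fun t => expR (c * t)) (fun t => c * expR (c * t)).
Proof.
move=> ab.
have cont : continuous (fun t : R => c * expR (c * t)).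
  move=> t; apply: cvgM; first exact: cvg_cst.
  apply: continuous_comp; last exact: continuous_expR.
  by apply: cvgM; [exact: cvg_cst|exact: cvg_id].
split.
  apply: continuous_compact_integrable; first exact: segment_compact.
  exact: continuous_subspaceT.
move=> t /andP[]; rewrite le_eqVlt => /predU1P[<- _|at_ tb].
  by rewrite set_itv1 Rintegral_set1 addr0.
rewrite /Rintegral (@continuous_FTC2 R _ (fun t => expR (c * t))) //.
- by rewrite /= [RHS]addrC subrK.
- exact: continuous_subspaceT.
- have dE x : derivable (fun t : R => expR (c * t)) x 1 by [].
  have cE : continuous (fun t : R => expR (c * t)).
    move=> x; apply: continuous_comp; last exact: continuous_expR.
    by apply: cvgM; [exact: cvg_cst|exact: cvg_id].
  split=> //; [apply: cvg_at_right_filter; exact: cE|apply: cvg_at_left_filter; exact: cE].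
- move=> x _; rewrite derive1E.
  by rewrite derive_val; rewrite scaler1 mulrC.
Qed.

(** For G the integral of [j], the function exp(-a t) G(t) has density exp(-a t) (j - a G) <= H. The
    bound concerns the integral of [j], and its constants do not involve [j], as the truncation
    argument for processes requires. *)
Lemma gronwall (h a H : R) (j : R -> R) : 0 <= h -> 0 <= a -> 0 <= H ->
  mu.-integrable `[0, h] (EFin \o j) ->
  (forall t, 0 <= t <= h -> 0 <= j t) ->
  (forall t, 0 <= t <= h -> j t <= H + a * \int[mu]_(s in `[0, t]) j s) ->
  \int[mu]_(s in `[0, h]) j s <= expR (a * h) * (H * h).
Proof.
move=> h0 a0 H0 iJ j0 jle.
pose G t := \int[mu]_(s in `[0, t]) j s.
have pG : primitive_on 0 h G j.
  split=> // t _; rewrite /G set_itv1 Rintegral_set1 add0r; reflexivity.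
have pE := primitive_on_expR (- a) h0.
have [iEG EG] := primitive_on_mul h0 pE pG.
have := EG h; rewrite h0 lexx => /(_ isT).
rewrite [G 0]/G set_itv1 Rintegral_set1 mulr0 add0r => Eh.
have : expR (- a * h) * G h <= H * h.
  rewrite Eh; apply: (@le_trans _ _ (\int[mu]_(s in `[0, h]) H)).
    apply: le_Rintegral => //.
      apply: continuous_compact_integrable; first exact: segment_compact.
      by apply: continuous_subspaceT => x; exact: cvg_cst.
    move=> t; rewrite /= in_itv /= => th.
    have -> : - a * expR (- a * t) * G t + expR (- a * t) * j t =
      expR (- a * t) * (j t - a * G t) by ring.
    have e1 : expR (- a * t) <= 1.
      rewrite -expR0 ler_expR mulNr oppr_le0 mulr_ge0 //.
      by case/andP: th.
    have jH : j t - a * G t <= H by rewrite lerBlDr jle.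
    apply: (le_trans (ler_wpM2l (expR_ge0 _) jH)).
    by rewrite ler_piMl.
  have muE : fine (mu `[0, h]%classic) = h.
    rewrite lebesgue_measure_itv /= lte_fin; move: h0; rewrite le_eqVlt.
    by move=> /predU1P[<-|->] /=; rewrite ?ltxx ?subr0 ?oppr0 ?addr0.
  by rewrite (@Rintegral_cst _ (measurableTypeR R)) // muE.
by rewrite mulNr expRN mulrC ler_pdivrMr ?expR_gt0 // mulrC.
Qed.

End RealFubini.

(** * Convergence of the data-driven iteration, given the data identity *)

Section PolicyIterationConvergence.
Variables (R : realType) (n m : nat) (A : 'M[R]_n) (B : 'M[R]_(n, m)).
Variables (Rm : 'M[R]_m) (rho : R).
Hypotheses (pR : posdef Rm) (rho_gt0 : 0 < rho).
Let F := A - (rho / 2)%:M.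

Lemma hurwitz_shift (M : 'M[R]_n) (r : R) :
  0 <= r -> hurwitz M -> hurwitz (M - r%:M).
Proof.
move=> r0 /hurwitzP hM; apply/hurwitzP => al be a b ab.
rewrite !mulmxBl !mul_scalar_mx => /eqP; rewrite subr_eq => /eqP Ma.
move=> /eqP; rewrite subr_eq => /eqP Mb.
apply: (@le_lt_trans _ _ (al + r)); first by rewrite lerDl.
apply: (hM _ be a b ab).
  by rewrite Ma scalerDl addrAC.
by rewrite Mb scalerDl addrA.
Qed.

(** On an eigenvector, [lyap_eigen] equates 2 al times a positive number with a negative one. *)
Lemma hurwitz_posdef (M P S : 'M[R]_n) :
  posdef P -> posdef S -> lyap M P = - S -> hurwitz M.
Proof.
move=> [sP pP] [sS pS] LP; apply/hurwitzP => al be a b ab Ma Mb.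
have := lyap_eigen sP Ma Mb; rewrite LP !mulmxN !mulNmx.
rewrite ![fun_of_matrix (- _) 0 0]mxE => E.
have pos (W : 'M[R]_n) : (forall v : 'cV_n, v != 0 -> 0 < (v^T *m W *m v) 0 0) ->
    0 < (a^T *m W *m a) 0 0 + (b^T *m W *m b) 0 0.
  move=> pW; have ge0 (v : 'cV_n) : 0 <= (v^T *m W *m v) 0 0.
    by have [->|/pW/ltW//] := eqVneq v 0; rewrite mulmx0 mxE.
  by case/orP: ab => /pW h; [exact: ltr_wpDr|exact: ltr_wpDl].
have pa := pos _ pP; have pb := pos _ pS.
rewrite -(pmulr_llt0 _ pa) -(pmulr_rlt0 _ (ltr0n R 2)) mulrA -E.
by rewrite -opprD oppr_lt0.
Qed.

Lemma discounted_are (P Q : 'M[R]_n) : P^T = P ->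
  rho *: P = P *m A + A^T *m P - P *m B *m invmx Rm *m B^T *m P + Q ->
  lyap F P - (gain B Rm P)^T *m Rm *m gain B Rm P + Q = 0.
Proof.
move=> sP E; have uR := posdef_unitmx pR.
have -> : (gain B Rm P)^T *m Rm *m gain B Rm P = P *m B *m invmx Rm *m B^T *m P.
  rewrite /gain !trmx_mul !trmxK trmx_inv (proj1 pR) sP !mulmxA.
  by rewrite -(mulmxA _ (invmx Rm) Rm) mulVmx // mulmx1.
have -> : lyap F P = P *m A + A^T *m P - rho *: P.
  rewrite /lyap /F [(A - _)^T]linearB /= tr_scalar_mx mulmxBr mulmxBl.
  rewrite mul_mx_scalar mul_scalar_mx addrACA -opprD -scalerDl.
  by rewrite -mulrDl -mulr2n -(mulr_natr rho) mulfK ?pnatr_eq0 // (addrC (A^T *m P)).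
by rewrite E; move: (P *m A) (A^T *m P) (P *m B *m _ *m _ *m _) => p q r;
  apply/matrixP => i j; rewrite !mxE; ring.
Qed.

Variables (X : R -> 'cV[R]_n) (V : R -> 'cV[R]_m) (s : nat -> R) (d : nat).
Hypothesis dataE : forall j : nat,
  disc_gram rho X (s j.+1) - disc_gram rho X (s j) =
  - rho *: momentXX rho X (s j) (s j.+1)
  + (A *m momentXX rho X (s j) (s j.+1) + momentXX rho X (s j) (s j.+1) *m A^T)
  + (B *m (momentXV rho X V (s j) (s j.+1))^T
     + momentXV rho X V (s j) (s j.+1) *m B^T).
Hypothesis rankE :
  \rank (row_mx (data_IX rho X s d) (data_IXV rho X V s d))
    = (m * n + (n * n.+1)./2)%N.

Lemma policy_iteration_cvg (Q Y : 'M[R]_n) (K L : nat -> 'M[R]_(m, n))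
    (P : nat -> 'M[R]_n) :
  possemidef Q -> Y^T = Y ->
  rho *: Y = Y *m A + A^T *m Y - Y *m B *m invmx Rm *m B^T *m Y + Q ->
  hurwitz (F - B *m gain B Rm Y) ->
  hurwitz (A - B *m K 0%N) ->
  (forall k, pi_solve rho X V s d (- ((K k)^T *m Rm *m K k) - Q)
     (K k) (P k.+1) (L k.+1)) ->
  (forall k, K k.+1 = invmx Rm *m L k.+1) ->
  K @ \oo --> gain B Rm Y.
Proof.
move=> pQ sY AY hY hK0 hP hK.
have step k : hurwitz (F - B *m K k) ->
    [/\ (P k.+1)^T = P k.+1, L k.+1 = B^T *m P k.+1 &
      lyap (F - B *m K k) (P k.+1) = - (Q + (K k)^T *m Rm *m K k)].
  move=> hk; have [|sP LP EL] := pi_solve_exact dataE rankE hk _ (hP k).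
    have [sK _] := psd_congr (K k) (posdefW pR).
    have TB (p q : 'M[R]_n) : (- p - q)^T = - p^T - q^T.
      by rewrite linearB linearN.
    by rewrite TB sK (proj1 pQ).
  by split=> //; rewrite LP opprD addrC.
have AY' := discounted_are sY AY.
(* The initial gain stabilizes [A]; moving the spectrum left by rho / 2 keeps the loop stable. *)
have hK0' : hurwitz (F - B *m K 0%N).
  have -> : F - B *m K 0%N = A - B *m K 0%N - (rho / 2)%:M by rewrite /F addrAC.
  apply: hurwitz_shift hK0.
  by rewrite divr_ge0 // ltW.
apply: (kleinman (F := F) (Q := Q) (P := P) pR pQ hK0' _ _ sY AY' hY) => k /step[sP EL LP].
  by split; [exact: sP|exact: LP].
by rewrite hK EL /gain mulmxA.
Qed.

End PolicyIterationConvergence.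

(** * The data identity along an absolutely continuous trajectory *)

Section DataIdentity.
Variable R : realType.
Notation mu := (@lebesgue_measure R).

Lemma Rintegral_lincomb d (T : measurableType d) (m : {measure set T -> \bar R})
    (D : set T) (I : finType) (c : I -> R) (f : I -> T -> R) : measurable D ->
  (forall i, m.-integrable D (EFin \o f i)) ->
  m.-integrable D (EFin \o (fun t => \sum_i c i * f i t)) /\
  \int[m]_(t in D) (\sum_i c i * f i t) = \sum_i c i * \int[m]_(t in D) f i t.
Proof.
move=> mD iF; elim: (index_enum I) => [|i r [i1 e1]].
  rewrite big_nil (_ : (fun t => _) = cst 0); last first.
    by apply/funext => t; rewrite big_nil.
  split; first exact: integrable0.
  by rewrite /Rintegral integral0.
have ic : m.-integrable D (EFin \o (fun t => c i * f i t)).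
  exact: integrableZl (iF i).
rewrite big_cons (_ : (fun t => _) =
  (fun t => c i * f i t + \sum_(j <- r) c j * f j t)); last first.
  by apply/funext => t; rewrite big_cons.
split; first exact: integrableD ic i1.
by rewrite RintegralD // e1 RintegralZl.
Qed.

Variables (n m : nat) (A : 'M[R]_n) (B : 'M[R]_(n, m)) (rho : R).
Variables (X : R -> 'cV[R]_n) (V : R -> 'cV[R]_m).
Hypothesis iV : forall h l, 0 <= h -> mu.-integrable `[0, h] (EFin \o (fun t => V t l 0)).
Hypothesis pX : forall h i, 0 <= h ->
  primitive_on 0 h (fun t => X t i 0) (fun t => (A *m X t + B *m V t) i 0).

(** Entrywise the product rule for exp(-rho t) X_i X_j, with the densities of X_i and X_j expanded
    along rows of [A] and [B]. *)
Lemma gram_identity (a b : R) : 0 <= a -> a <= b ->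
  disc_gram rho X b - disc_gram rho X a =
  - rho *: momentXX rho X a b
  + (A *m momentXX rho X a b + momentXX rho X a b *m A^T)
  + (B *m (momentXV rho X V a b)^T + momentXV rho X V a b *m B^T).
Proof.
move=> a0 ab; have b0 := le_trans a0 ab.
have pX' i := primitive_on_sub a0 ab (lexx b) (pX i b0).
have iV' l : mu.-integrable `[a, b] (EFin \o (fun t => V t l 0)).
  exact: integrable_subitv a0 (lexx b) (iV l b0).
have pE := primitive_on_expR (- rho) ab.
pose e t := expR (- rho * t).
have iXV i l : mu.-integrable `[a, b] (EFin \o (fun t => e t * X t i 0 * V t l 0)).
  exact: primitive_on_mul_integrable ab (primitive_on_mul ab pE (pX' i)) (iV' l).
(* Multiplication by 1 reads the integrability of an absolutely continuous function off
   [primitive_on_mul_integrable]. *)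
have cst1 : mu.-integrable `[a, b] (EFin \o (fun=> 1 : R)).
  apply: continuous_compact_integrable; first exact: segment_compact.
  by apply: continuous_subspaceT => x; exact: cvg_cst.
have iXX i j : mu.-integrable `[a, b] (EFin \o (fun t => e t * X t i 0 * X t j 0)).
  have := primitive_on_mul_integrable ab
    (primitive_on_mul ab (primitive_on_mul ab pE (pX' i)) (pX' j)) cst1.
  by congr (mu.-integrable _ _); apply/funext => t; rewrite /= mulr1.
have eE t : expR (- (rho * t)) = e t by rewrite /e mulNr.
have XXE i j : momentXX rho X a b i j = \int[mu]_(t in `[a, b]) (e t * X t i 0 * X t j 0).
  rewrite mxE; apply: eq_Rintegral => t _.
  by rewrite !mxE big_ord1 !mxE eE mulrA.
have XVE i l : momentXV rho X V a b i l = \int[mu]_(t in `[a, b]) (e t * X t i 0 * V t l 0).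
  rewrite mxE; apply: eq_Rintegral => t _.
  by rewrite !mxE big_ord1 !mxE eE mulrA.
apply/matrixP => i j.
have [_ /(_ b)] := primitive_on_mul ab pE (primitive_on_mul ab (pX' i) (pX' j)).
rewrite ab lexx => /(_ isT).
pose c1 := fun k => A i k; pose c2 := fun k => A j k.
pose d1 := fun l => B i l; pose d2 := fun l => B j l.
have [s1 e1] := @Rintegral_lincomb _ (measurableTypeR R) mu `[a, b] _ c1
  (fun k t => e t * X t k 0 * X t j 0) (measurable_itv _) (fun k => iXX k j).
have [s2 e2] := @Rintegral_lincomb _ (measurableTypeR R) mu `[a, b] _ c2
  (fun k t => e t * X t i 0 * X t k 0) (measurable_itv _) (fun k => iXX i k).
have [s3 e3] := @Rintegral_lincomb _ (measurableTypeR R) mu `[a, b] _ d1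
  (fun l t => e t * X t j 0 * V t l 0) (measurable_itv _) (fun l => iXV j l).
have [s4 e4] := @Rintegral_lincomb _ (measurableTypeR R) mu `[a, b] _ d2
  (fun l t => e t * X t i 0 * V t l 0) (measurable_itv _) (fun l => iXV i l).
have s5 : mu.-integrable `[a, b] (EFin \o (fun t => - rho * (e t * X t i 0 * X t j 0))).
  exact: integrableZl (iXX i j).
pose G t := - rho * (e t * X t i 0 * X t j 0)
  + ((\sum_k c1 k * (e t * X t k 0 * X t j 0) + \sum_k c2 k * (e t * X t i 0 * X t k 0))
  + (\sum_l d1 l * (e t * X t j 0 * V t l 0) + \sum_l d2 l * (e t * X t i 0 * V t l 0))).
rewrite [X in _ = _ + X](_ : _ = \int[mu]_(t in `[a, b]) G t); last first.
  apply: eq_Rintegral => t _; rewrite /G -/(e t) !mxE.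
  have S1 k (c : 'I_k -> R) (z : 'I_k -> R) (w v : R) :
     \sum_i c i * (w * z i * v) = (\sum_i c i * z i) * (w * v).
    by rewrite mulr_suml; apply: eq_bigr => o _; ring.
  have S2 k (c : 'I_k -> R) (z : 'I_k -> R) (w : R) :
     \sum_i c i * (w * z i) = (\sum_i c i * z i) * w.
    by rewrite mulr_suml; apply: eq_bigr => o _; ring.
  by rewrite S1 !S2 /c1 /c2 /d1 /d2; ring.
pose S1 t := \sum_k c1 k * (e t * X t k 0 * X t j 0).
pose S2 t := \sum_k c2 k * (e t * X t i 0 * X t k 0).
pose S3 t := \sum_l d1 l * (e t * X t j 0 * V t l 0).
pose S4 t := \sum_l d2 l * (e t * X t i 0 * V t l 0).
have s12 : mu.-integrable `[a, b] (EFin \o (fun t => S1 t + S2 t)).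
  exact: integrableD s1 s2.
have s34 : mu.-integrable `[a, b] (EFin \o (fun t => S3 t + S4 t)).
  exact: integrableD s3 s4.
have s1234 : mu.-integrable `[a, b] (EFin \o (fun t => (S1 t + S2 t) + (S3 t + S4 t))).
  exact: integrableD s12 s34.
have mI : measurable (`[a, b]%classic : set (measurableTypeR R)) by exact: measurable_itv.
rewrite /G (RintegralD mI s5 s1234) (RintegralD mI s12 s34).
rewrite (RintegralD mI s1 s2) (RintegralD mI s3 s4).
rewrite e1 e2 e3 e4 RintegralZl // => E.
move: (momentXX rho X a b) XXE (momentXV rho X V a b) XVE => M XXE N XVE.
rewrite !mxE !big_ord1 !mxE !eE E [LHS]addrC addKr XXE.
rewrite -addrA; congr (_ + (_ + _)); congr (_ + _); apply: eq_bigr => k _; rewrite ?mxE.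
- by rewrite XXE.
- by rewrite XXE mulrC.
- by rewrite XVE.
- by rewrite XVE mulrC.
Qed.

End DataIdentity.

(** * Integrability and mean of the state *)

Section NormalMoments.
Variable R : realType.
Notation mu := (@lebesgue_measure R).

(** The Radon-Nikodym derivative agrees almost everywhere with [normal_pdf], since both have the
    same integral over every measurable set. *)
Lemma ge0_integral_normal_prob (s : R) (f : R -> \bar R) :
  measurable_fun setT f -> (forall x, 0 <= f x)%E ->
  (\int[normal_prob 0 s]_x f x = \int[mu]_x (f x * (normal_pdf 0 s x)%:E))%E.
Proof.
move=> mf f0; have dom := normal_prob_dominates (0 : R) s.
rewrite -(Radon_Nikodym_SigmaFinite.change_of_variables dom f0 measurableT mf).
have ig := Radon_Nikodym_SigmaFinite.f_integrable dom.
have mpdf : measurable_fun setT (EFin \o normal_pdf 0 s : R -> \bar R).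
  by apply/measurable_EFinP; exact: measurable_normal_pdf.
apply: ae_eq_integral => //.
- by apply: emeasurable_funM => //; exact: (measurable_int mu ig).
- exact: emeasurable_funM.
apply: ae_eqe_mul2l; apply: integral_ae_eq => //.
move=> E _ mE; rewrite -(Radon_Nikodym_SigmaFinite.f_integral dom) //.
Qed.

Lemma normal_pdf_even (s x : R) : s != 0 -> normal_pdf 0 s (- x) = normal_pdf 0 s x.
Proof.
by move=> s0; rewrite !normal_pdfE //= /normal_fun !subr0 sqrrN.
Qed.

(* AM-GM: [|x| / s <= 1 + x^2 / (4 s^2) <= exp (x^2 / (4 s^2))]. *)
Lemma abs_normal_pdf_le (s x : R) : 0 < s ->
  `|x| * normal_pdf 0 s x <= Num.sqrt 2 * s * normal_pdf 0 (Num.sqrt 2 * s) x.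
Proof.
move=> s0; have q0 : 0 < Num.sqrt 2 :> R by rewrite sqrtr_gt0.
have qs0 : 0 < Num.sqrt 2 * s by rewrite mulr_gt0.
rewrite !normal_pdfE ?gt_eqF //= /normal_fun /normal_peak !subr0.
have q2 : (Num.sqrt 2 * s) ^+ 2 = s ^+ 2 *+ 2.
  by rewrite exprMn sqr_sqrtr // mulr_natl.
have -> : Num.sqrt ((Num.sqrt 2 * s) ^+ 2 * pi *+ 2) =
    Num.sqrt 2 * Num.sqrt (s ^+ 2 * pi *+ 2).
  rewrite q2 -sqrtrM //; congr Num.sqrt.
  by ring.
have p0 : 0 < Num.sqrt (s ^+ 2 * pi *+ 2).
  by rewrite sqrtr_gt0 pmulrn_lgt0 // mulr_gt0 ?exprn_gt0 ?pi_gt0.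
set p := Num.sqrt (s ^+ 2 * _ *+ 2) in p0 *.
set y := x ^+ 2 / (s ^+ 2 *+ 2 *+ 2).
have s20 : 0 < s ^+ 2 by rewrite exprn_gt0.
have -> : - x ^+ 2 / (s ^+ 2 *+ 2) = - y - y.
  by rewrite /y; field; rewrite gt_eqF.
have -> : - x ^+ 2 / ((Num.sqrt 2 * s) ^+ 2 *+ 2) = - y by rewrite q2 mulNr.
have E1 : `|x| <= s * expR y.
  have le1 : 1 + y <= expR y by exact: expR_ge1Dx.
  apply: (@le_trans _ _ (s * (1 + y))); last by rewrite ler_pM2l.
  rewrite -subr_ge0.
  have -> : s * (1 + y) - `|x| = (s - `|x| / 2) ^+ 2 / s.
    have x2 : x ^+ 2 = `|x| ^+ 2 by rewrite real_normK ?num_real.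
    by rewrite /y x2; field; rewrite gt_eqF.
  by rewrite divr_ge0 ?sqr_ge0 ?ltW.
rewrite expRD.
have -> : Num.sqrt 2 * s * ((Num.sqrt 2 * p)^-1 * expR (- y)) = p^-1 * (s * expR (- y)).
  by field; rewrite !gt_eqF.
rewrite mulrCA ler_pM2l ?invr_gt0 // mulrA ler_pM2r ?expR_gt0 //.
by rewrite expRN ler_pdivrMr ?expR_gt0.
Qed.

Lemma lebesgue_integral_opp (g : R -> \bar R) :
  measurable_fun setT g -> (forall x, 0 <= g x)%E ->
  (\int[mu]_x g (- x)%R = \int[mu]_x g x)%E.
Proof.
move=> mg g0.
have mN : measurable_fun setT (-%R : measurableTypeR R -> measurableTypeR R).
  exact: (@oppr_measurable R setT).
have {}mg : measurable_fun setT (g : measurableTypeR R -> \bar R) := mg.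
rewrite -[LHS](ge0_integral_pushforward mN mu measurableT mg (fun y _ => g0 y)).
by apply: eq_measure_integral => U mU _; exact: lebesgue_measureN.
Qed.

(** [abs_normal_pdf_le] bounds the first absolute moment by [Num.sqrt 2 * s] times the total mass 1
    of a wider normal law. The mean vanishes because the density is even, so the positive and
    negative parts have equal finite integrals. *)
Lemma normal_moments d (T : measurableType d) (P : probability T R) (X : T -> R) (s : R) :
  0 < s -> measurable_fun setT X ->
  (forall U : set R, measurable U -> P (X @^-1` U) = normal_prob 0 s U) ->
  [/\ P.-integrable setT (EFin \o X),
      (\int[P]_w `|X w|%:E <= (Num.sqrt 2 * s)%:E)%E &
      \int[P]_w X w = 0].
Proof.
move=> s0 mX lawX; have sn0 : s != 0 by rewrite gt_eqF.
have qs0 : 0 < Num.sqrt 2 * s by rewrite mulr_gt0 // sqrtr_gt0.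
have mpdf t : measurable_fun setT (EFin \o normal_pdf 0 t : R -> \bar R).
  by apply/measurable_EFinP; exact: measurable_normal_pdf.
have transfer (f : R -> \bar R) : measurable_fun setT f -> (forall x, 0 <= f x)%E ->
    (\int[P]_w f (X w) = \int[mu]_x (f x * (normal_pdf 0 s x)%:E))%E.
  move=> mf f0; rewrite -ge0_integral_normal_prob //.
  have {}mX : measurable_fun setT (X : T -> measurableTypeR R) := mX.
  have {}mf : measurable_fun setT (f : measurableTypeR R -> \bar R) := mf.
  rewrite -[LHS](ge0_integral_pushforward mX P measurableT mf (fun y _ => f0 y)).
  by apply: eq_measure_integral => U mU _; exact: lawX.
have abs_le : (\int[P]_w `|X w|%:E <= (Num.sqrt 2 * s)%:E)%E.
  rewrite (transfer (fun x => `|x|%:E)) //; last first.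
    by apply/measurable_EFinP; exact: normr_measurable.
  apply: (@le_trans _ _ (\int[mu]_x ((Num.sqrt 2 * s)%:E *
      (normal_pdf 0 (Num.sqrt 2 * s) x)%:E)))%E.
    apply: ge0_le_integral => //.
    - by move=> x _; rewrite mule_ge0 ?lee_fin ?normal_pdf_ge0.
    - apply: emeasurable_funM; last exact: mpdf.
      by apply/measurable_EFinP; exact: normr_measurable.
    - by apply: emeasurable_funM; [exact: measurable_cst|exact: mpdf].
    - by move=> x _; rewrite -!EFinM lee_fin abs_normal_pdf_le.
  rewrite ge0_integralZl_EFin ?(ltW qs0) //; last exact: mpdf.
    by rewrite integral_normal_pdf mule1.
  by move=> x _; rewrite lee_fin normal_pdf_ge0.
have iX : P.-integrable setT (EFin \o X).
  apply/integrableP; split; first exact/measurable_EFinP.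
  by apply: le_lt_trans abs_le _; exact: ltry.
split=> //.
rewrite /Rintegral integralE.
pose fp (x : R) : \bar R := (Num.max x 0)%:E.
have mfp : measurable_fun setT fp.
  by apply/measurable_EFinP; apply: measurable_maxr.
have fp0 x : (0 <= fp x)%E by rewrite lee_fin le_max lexx orbT.
have -> : (\int[P]_w (EFin \o X)^\+ w = \int[P]_w fp (X w))%E.
  by rewrite funerpos.
have -> : (\int[P]_w (EFin \o X)^\- w = \int[P]_w (fp \o -%R) (X w))%E.
  by rewrite funerneg.
have mfN : measurable_fun setT (fp \o -%R) by apply: measurableT_comp.
rewrite (transfer fp) // (transfer (fp \o -%R)) //; last by move=> x; exact: fp0.
suff -> : (\int[mu]_x ((fp \o -%R) x * (normal_pdf 0 s x)%:E) =
   \int[mu]_x (fp x * (normal_pdf 0 s x)%:E))%E.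
  rewrite subee // -(transfer fp) // ge0_fin_numE; last exact: integral_ge0.
  apply: le_lt_trans (ltry (Num.sqrt 2 * s)); apply: le_trans abs_le.
  apply: ge0_le_integral => //.
  - exact: measurableT_comp mfp mX.
  - by apply/measurable_EFinP; apply: measurableT_comp.
  - by move=> w _; rewrite lee_fin ge_max normr_ge0 ler_norm.
rewrite -[RHS]lebesgue_integral_opp.
- by apply: eq_integral => x _; rewrite /= normal_pdf_even.
- by apply: emeasurable_funM; [exact: mfp|exact: mpdf].
- by move=> x; rewrite mule_ge0 // lee_fin normal_pdf_ge0.
Qed.

End NormalMoments.

(** * Processes on a finite time window *)

Section Processes.
Context {R : realType} {d : measure_display} {T : measurableType d}.
Variable P : probability T R.
Notation mu := (@lebesgue_measure R).

Lemma ae_le_Rintegral (f g : T -> R) : measurable_fun setT f ->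
  P.-integrable setT (EFin \o g) -> (forall w, 0 <= f w) ->
  {ae P, forall w, f w <= g w} ->
  P.-integrable setT (EFin \o f) /\ \int[P]_w f w <= \int[P]_w g w.
Proof.
move=> mf ig f0 fg.
have mg : measurable_fun setT g by apply/measurable_EFinP; exact: (measurable_int P ig).
have mEf : measurable_fun setT (EFin \o f) by exact/measurable_EFinP.
have mEg : measurable_fun setT (EFin \o (fun w => `|g w|)).
  by apply/measurable_EFinP; exact: measurableT_comp.
have le1 : (\int[P]_w (f w)%:E <= \int[P]_w `|g w|%:E)%E.
  apply: ae_ge0_le_integral => //.
  - by move=> w _; rewrite lee_fin.
  - by apply: filterS fg => w fgw _; rewrite lee_fin (le_trans fgw) // ler_norm.
have if_ : P.-integrable setT (EFin \o f).
  apply/integrableP; split=> //.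
  under eq_integral do rewrite /= ger0_norm //.
  apply: (le_lt_trans le1); have /integrableP[_] := ig.
  by under eq_integral do rewrite /=.
split=> //.
(* The minimum alters [f] on a null set only and makes the inequality hold everywhere, as
   [le_Rintegral] is used with a pointwise bound. *)
have -> : \int[P]_w f w = \int[P]_w Num.min (f w) (g w).
  congr fine; apply: ae_eq_integral => //.
    by apply/measurable_EFinP; exact: measurable_minr.
  by apply: filterS fg => w fgw _ /=; rewrite min_l.
apply: le_Rintegral => //; last by move=> w _; rewrite ge_min lexx orbT.
apply: (le_integrable measurableT _ _
  (integrableD measurableT (integrable_norm if_) (integrable_norm ig))).
  by apply/measurable_EFinP; exact: measurable_minr.
move=> w _ /=; rewrite lee_fin [leRHS]ger0_norm ?addr_ge0 //.
by rewrite minEle; case: ifP => _; rewrite ?lerDl ?lerDr.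
Qed.

Lemma ae_eq_Rintegral (f g : T -> R) : measurable_fun setT f ->
  measurable_fun setT g -> {ae P, forall w, f w = g w} ->
  \int[P]_w f w = \int[P]_w g w.
Proof.
move=> mf mg fg; congr fine; apply: ae_eq_integral => //.
- exact/measurable_EFinP.
- exact/measurable_EFinP.
- by apply: filterS fg => w fgw _ /=; rewrite fgw.
Qed.

Definition jointly_measurable (Z : R -> T -> R) :=
  measurable_fun (`[(0 : R), +oo[ `*` [set: T]) (fun tw : R * T => Z tw.1 tw.2).

(** Extension by zero outside [[0, h]], so that Fubini's theorem applies on the whole product space
    to processes constrained only at nonnegative times. *)
Definition windowed (h : R) (Z : R -> T -> R) (tw : R * T) : R :=
  Z tw.1 tw.2 * \1_(`[0, h]%classic) tw.1.

Definition integrable_process (h : R) (Z : R -> T -> R) :=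
  (mu \x P)%E.-integrable setT (EFin \o windowed h Z).

Lemma measurable_window (h : R) :
  measurable (`[0, h]%classic `*` setT : set (measurableTypeR R * T)).
Proof. by apply: measurableX => //; exact: measurable_itv. Qed.

Lemma windowed_patch h Z :
  windowed h Z = (fun tw : measurableTypeR R * T => Z tw.1 tw.2)
    \_ (`[0, h]%classic `*` setT).
Proof.
apply/funext => -[t w]; rewrite /windowed patchE indicE /=.
have -> : ((t, w) \in `[0, h] `*` setT) = (t \in `[0, h]%classic).
  by apply/idP/idP; rewrite !inE /=; [case|split].
by case: (t \in _); rewrite ?mulr1 ?mulr0.
Qed.

Lemma measurable_windowed h Z : jointly_measurable Z ->
  measurable_fun setT (windowed h Z : measurableTypeR R * T -> R).
Proof.
move=> mZ; rewrite windowed_patch.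
apply: (measurable_restrictT _ (measurable_window h)).1.
have mD : measurable (`[(0 : R), +oo[ `*` setT : set (measurableTypeR R * T)).
  by apply: measurableX => //; exact: measurable_itv.
have mZ' : measurable_fun (`[(0 : R), +oo[ `*` setT)
  (fun tw : measurableTypeR R * T => Z tw.1 tw.2) by exact: mZ.
apply: (measurable_funS mD _ mZ') => -[t w] [/= + _].
by rewrite !in_itv /= => /andP[-> _].
Qed.

Lemma measurable_section Z t : jointly_measurable Z -> 0 <= t ->
  measurable_fun setT (Z t).
Proof.
move=> mZ t0.
apply: (@measurable_comp _ _ _ _ _ _ (`[(0 : R), +oo[ `*` [set: T])
   (fun tw : R * T => Z tw.1 tw.2) setT (pair t)) => //.
- by apply: measurableX => //; exact: measurable_itv.
- by move=> _ [w _ <-]; split=> //=; rewrite in_itv /= t0.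
Qed.

Lemma integrable_process_sub (t h : R) Z : t <= h ->
  integrable_process h Z -> integrable_process t Z.
Proof.
move=> th iZ.
have := integrable_indicM (measurable_window t) iZ.
congr (_.-integrable _ _); apply/funext => -[s w] /=; congr EFin.
rewrite /windowed /= !indicE.
have -> : ((s, w) \in `[0, t] `*` setT) = (s \in `[0, t]%classic).
  by apply/idP/idP; rewrite !inE /=; [case|split].
case: (boolP (s \in `[0, t]%classic)) => st; rewrite ?mulr0 ?mulr1 //.
rewrite mem_set ?mulr1 //; move: st; rewrite inE /= !in_itv /= => /andP[-> st].
exact: le_trans st th.
Qed.

Lemma integrable_process_paths h Z : integrable_process h Z ->
  {ae P, forall w, mu.-integrable `[0, h] (EFin \o Z^~ w)}.
Proof.
move=> iZ; have := ae_integrable2 iZ; apply: filterS => w iw.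
apply: (@integrable_mkcond _ (measurableTypeR R) _ mu `[0, h] (EFin \o Z^~ w)
  (measurable_itv _)).2.
rewrite restrict_EFin; move: iw; congr (_.-integrable _ _); apply/funext => t /=.
congr EFin; rewrite /windowed /= patchE indicE.
by case: (t \in _); rewrite ?mulr1 ?mulr0.
Qed.

Lemma integrable_process_fubini h Z : integrable_process h Z ->
  [/\ P.-integrable setT (EFin \o (fun w => \int[mu]_(t in `[0, h]) Z t w)),
      mu.-integrable `[0, h] (EFin \o (fun t => \int[P]_w Z t w)) &
      \int[P]_w \int[mu]_(t in `[0, h]) Z t w =
      \int[mu]_(t in `[0, h]) \int[P]_w Z t w].
Proof.
move=> iZ; have [i1 i2 e] := fubini_real iZ.
have E1 w : \int[mu]_t windowed h Z (t, w) = \int[mu]_(t in `[0, h]) Z t w.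
  rewrite [RHS]Rintegral_mkcond; apply: eq_Rintegral => t _.
  by rewrite /windowed /= patchE indicE; case: (t \in _); rewrite ?mulr1 ?mulr0.
have E2 t : \int[P]_w windowed h Z (t, w) =
    ((fun t => \int[P]_w Z t w) \_ `[0, h]) t.
  rewrite patchE /windowed /= indicE; case: (t \in _).
    by apply: eq_Rintegral => w _; rewrite mulr1.
  by under eq_Rintegral do rewrite mulr0; rewrite Rintegral_cst ?mul0r.
split.
- by move: i2; congr (_.-integrable _ _); apply/funext => w /=; rewrite E1.
- apply: (@integrable_mkcond _ (measurableTypeR R) _ mu `[0, h] _ (measurable_itv _)).2.
  rewrite restrict_EFin; move: i1; congr (_.-integrable _ _).
  by apply/funext => t /=; rewrite E2.
- rewrite [RHS]Rintegral_mkcond.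
  transitivity (\int[mu]_t \int[P]_w windowed h Z (t, w)).
    by rewrite e; apply: eq_Rintegral => w _; rewrite E1.
  by apply: eq_Rintegral => t _; rewrite E2.
Qed.

Lemma integrable_processP h Z : jointly_measurable Z ->
  (\int[P]_w \int[mu]_t `|windowed h Z (t, w)|%:E < +oo)%E ->
  integrable_process h Z.
Proof.
move=> mZ fZ; apply/integrable21ltyP => //.
by apply/measurable_EFinP; exact: measurable_windowed.
Qed.

Lemma le_integrable_process h Z (G : R * T -> R) : jointly_measurable Z ->
  (mu \x P)%E.-integrable setT (EFin \o G) ->
  (forall t w, 0 <= t <= h -> `|Z t w| <= G (t, w)) ->
  integrable_process h Z.
Proof.
move=> mZ iG ZG; apply: (le_integrable measurableT _ _ iG).
  by apply/measurable_EFinP; exact: measurable_windowed.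
move=> [t w] _ /=; rewrite lee_fin /windowed /= indicE.
case: (boolP (t \in _)); last by rewrite mulr0 normr0.
rewrite inE /= in_itv /= => /(ZG t w) h1.
by rewrite mulr1 (le_trans h1) // ler_norm.
Qed.

End Processes.

Section GronwallProcess.
Context {R : realType} {d : measure_display} {T : measurableType d}.
Variable P : probability T R.
Notation mu := (@lebesgue_measure R).

Lemma measurable_time_integral (G : measurableTypeR R * T -> \bar R) :
  measurable_fun setT G -> (forall z, 0 <= G z)%E ->
  measurable_fun setT (fun w => \int[mu]_t G (t, w))%E.
Proof.
move=> mG G0.
exact: (@measurable_fun_fubini_tonelli_G _ _ (measurableTypeR R) T R mu G mG G0).
Qed.

Lemma window_one (h : R) : 0 <= h ->
  integrable_process P h (fun _ _ => 1).
Proof.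
move=> h0; apply: integrable_processP; first exact: measurable_cst.
have E w : (\int[mu]_t `|windowed h (fun (_ : R) (_ : T) => 1 : R) (t, w)|%:E = h%:E)%E.
  under eq_integral.
    move=> t _; rewrite /windowed /= mul1r ger0_norm ?indicE //.
    over.
  under eq_integral do rewrite -indicE.
  rewrite integral_indic //= ?setIT.
  rewrite lebesgue_measure_itv /= lte_fin; move: h0; rewrite le_eqVlt.
  by move=> /predU1P[<-|->] /=; rewrite ?ltxx ?oppr0 ?adde0 ?sube0.
under eq_integral do rewrite E.
by rewrite (integral_cst P measurableT) /= probability_setT mule1 ltry.
Qed.

Lemma control_integrable (m p : nat) (rho : R) (W : R -> T -> 'cV[R]_p)
    (u : R -> T -> 'cV[R]_m) (h : R) (l : 'I_m) : 0 <= rho -> 0 <= h ->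
  admissible P rho W u ->
  integrable_process P h (fun t w => u t w l 0).
Proof.
move=> rho0 h0 [mu_ _ fu].
pose q t w := expR (- (rho * t)) * normsq (u t w).
have q0 t w : 0 <= q t w.
  by rewrite mulr_ge0 ?expR_ge0 // sumr_ge0 // => i _; exact: sqr_ge0.
have mD : measurable (`[(0 : R), +oo[ `*` setT : set (measurableTypeR R * T)).
  by apply: measurableX => //; exact: measurable_itv.
have mq : jointly_measurable q.
  apply: measurable_funM.
    apply: measurable_funS (@subsetT _ _) _ => //.
    apply: measurableT_comp => //; apply: measurableT_comp => //.
    exact: measurable_funM.
  apply: measurable_sum => i; apply: measurable_funX; exact: mu_.
pose Q : measurableTypeR R * T -> R :=
  (fun tw => q tw.1 tw.2) \_ (`[(0 : R), +oo[ `*` setT).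
have mQ : measurable_fun setT Q by apply: (measurable_restrictT _ mD).1.
have iq : integrable_process P h q.
  apply: integrable_processP => //; apply: le_lt_trans fu.
  have QE w : (\int[mu]_(t in `[0%R, +oo[) (expR (- (rho * t)) * normsq (u t w))%R%:E =
      \int[mu]_t (Q (t, w))%:E)%E.
    rewrite integral_mkcond; apply: eq_integral => t _; rewrite /Q !patchE /=.
    have -> : ((t, w) \in `[0, +oo[ `*` setT) = (t \in `[(0 : R), +oo[%classic).
      by apply/idP/idP; rewrite !inE /=; [case|split].
    by case: ifP.
  under [leRHS]eq_integral do rewrite QE.
  apply: ge0_le_integral => //.
  - by move=> w _; exact: integral_ge0.
  - apply: (measurable_time_integral (G := fun tw => `|windowed h q tw|%:E)) => //.
    apply/measurable_EFinP; apply: measurableT_comp => //.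
    exact: measurable_windowed.
  - apply: (measurable_time_integral (G := EFin \o Q)).
      exact/measurable_EFinP.
    by move=> x; rewrite lee_fin /Q patchE; case: ifP.
  move=> w _; apply: ge0_le_integral => //.
  - apply/measurable_EFinP; apply: measurableT_comp => //.
    apply: (measurableT_comp (measurable_windowed h mq)).
    exact: pair2_measurable.
  - apply/measurable_EFinP; apply: (measurableT_comp mQ).
    exact: pair2_measurable.
  move=> t _; rewrite lee_fin windowed_patch /Q !patchE.
  case: ifPn => [|_]; last by rewrite normr0; case: ifP.
  rewrite inE /= => -[]; rewrite in_itv /= => /andP[t0 _] _.
  by rewrite mem_set ?ger0_norm //=; split=> //; rewrite in_itv /= t0.
(* The factor [expR (rho * h)] compensates the discount anywhere in [[0, h]], so [G] dominates 1 +
   |u|^2 there. *)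
pose G (tw : R * T) :=
  windowed h (fun (_ : R) (_ : T) => 1 : R) tw + expR (rho * h) * windowed h q tw.
have iG : (mu \x P)%E.-integrable setT (EFin \o G).
  have i1 := window_one h0; rewrite /integrable_process in i1 iq.
  have i2 := integrableZl measurableT (expR (rho * h)) iq.
  have := integrableD measurableT i1 i2.
  by apply: eq_integrable => // tw _.
apply: le_integrable_process iG _; first exact: mu_.
move=> t w th; rewrite /G /windowed /= indicE mem_set /= ?in_itv ?th //= !mulr1.
have nu : u t w l 0 ^+ 2 <= normsq (u t w).
  by rewrite /normsq (bigD1 l) //= lerDl sumr_ge0 // => i _; exact: sqr_ge0.
have ab : `|u t w l 0| <= 1 + u t w l 0 ^+ 2.
  have -> : u t w l 0 ^+ 2 = `|u t w l 0| ^+ 2 by rewrite real_normK ?num_real.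
  have := sqr_ge0 (`|u t w l 0| - 1); have := sqr_ge0 (`|u t w l 0|); nra.
apply: (le_trans ab); rewrite lerD2l (le_trans nu) //.
rewrite /q mulrA -expRD ler_peMl; last first.
- rewrite -expR0 ler_expR -mulrBr mulr_ge0 // subr_ge0.
  by case/andP: th.
- by rewrite sumr_ge0 // => i _; exact: sqr_ge0.
by [].
Qed.

(* Gronwall's inequality needs the integrability to be proved: it is applied to
   [eta] restricted to the events where the time integral of [eta] is at most [N],
   which gives a bound independent of [N]. *)
Lemma gronwall_process (h a H : R) (eta hb : R -> T -> R) :
  0 <= h -> 0 <= a -> 0 <= H -> jointly_measurable eta ->
  (forall t w, 0 <= eta t w) -> (forall t w, 0 <= hb t w) ->
  {ae P, forall w, mu.-integrable `[0, h] (EFin \o eta^~ w)} ->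
  (forall t, 0 <= t <= h -> P.-integrable setT (EFin \o hb t)) ->
  (forall t, 0 <= t <= h -> \int[P]_w hb t w <= H) ->
  {ae P, forall w, forall t, 0 <= t <= h ->
    eta t w <= hb t w + a * \int[mu]_(s in `[0, t]) eta s w} ->
  integrable_process P h eta.
Proof.
move=> h0 a0 H0 meta eta0 hb0 paths ihb hbH etale.
have weta0 tw : 0 <= windowed h eta tw by rewrite mulr_ge0 // indicE.
have mweta := measurable_windowed h meta.
pose S w := (\int[mu]_t (windowed h eta (t, w))%:E)%E.
have S0 w : (0 <= S w)%E by apply: integral_ge0 => t _; rewrite lee_fin.
have mS : measurable_fun setT S.
  apply: (measurable_time_integral (G := EFin \o windowed h eta)) => [|z].
    exact/measurable_EFinP.
  by rewrite lee_fin.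
(* These events do not depend on time, so restricting to them commutes with the time integral. *)
pose Om N := [set w | (S w <= N%:R%:E)%E].
have mOm N : measurable (Om N).
  by have := emeasurable_fun_infty_c measurableT mS N%:R%:E; rewrite setTI.
pose f N t w := eta t w * \1_(Om N) w.
have f0 N t w : 0 <= f N t w by rewrite mulr_ge0 // indicE.
have mf N : jointly_measurable (f N).
  apply: measurable_funM; first exact: meta.
  apply: measurable_funS (@subsetT _ _) _ => //.
  by apply: measurableT_comp => //; exact: measurable_indic.
have wf N t w : windowed h (f N) (t, w) = windowed h eta (t, w) * \1_(Om N) w.
  by rewrite /windowed /f /= mulrAC.
have fS N w : (\int[mu]_t `|windowed h (f N) (t, w)|%:E =
    (S \_ (Om N)) w)%E.
  rewrite patchE /S; case: ifPn => wN.
    apply: eq_integral => t _; rewrite wf indicE wN mulr1 ger0_norm //.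
  by rewrite integral0_eq // => t _; rewrite wf indicE (negbTE wN) mulr0 normr0.
have if_ N : integrable_process P h (f N).
  apply: integrable_processP => //.
  apply: (@le_lt_trans _ _ (\int[P]_w (cst N%:R%:E w))%E); last first.
    by rewrite (integral_cst P measurableT) /= probability_setT mule1 ltry.
  apply: ge0_le_integral => //.
  - by move=> w _; exact: integral_ge0.
  - apply: (eq_measurable_fun (S \_ (Om N))).
      by move=> w _; rewrite fS.
    by apply: (measurable_restrictT _ (mOm N)).1; exact: measurable_funTS.
  - move=> w _; rewrite fS patchE; case: ifPn => [|_]; last by rewrite lee_fin.
    by move=> /set_mem.
pose Cst := expR (a * h) * (H * h).
(* By Fubini the mean of [f N] satisfies the hypothesis of [gronwall] with the same [a] and [H] for
   every [N]; off [Om N] the inequality is trivial, its left side being 0. *)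
have fC N : \int[P]_w \int[mu]_(t in `[0, h]) f N t w <= Cst.
  have [i1 i2 ->] := integrable_process_fubini (if_ N).
  apply: gronwall => // t th.
    by apply: Rintegral_ge0 => w _.
  have /andP[t0 t1] := th.
  have [i3 i4 e] := integrable_process_fubini (integrable_process_sub t1 (if_ N)).
  have iZ : P.-integrable setT
      (EFin \o (fun w => a * \int[mu]_(s in `[0, t]) f N s w)).
    by have := integrableZl measurableT a i3; apply: eq_integrable.
  pose g w := hb t w + a * \int[mu]_(s in `[0, t]) f N s w.
  have ig : P.-integrable setT (EFin \o g).
    by have := integrableD measurableT (ihb t th) iZ; apply: eq_integrable.
  have le_fg : {ae P, forall w, f N t w <= g w}.
    apply: filterS etale => w /(_ t th) ew.
    rewrite /g {1}/f indicE; case: (boolP (w \in Om N)) => wN; last first.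
      rewrite mulr0 addr_ge0 // mulr_ge0 //.
      by apply: Rintegral_ge0 => s _.
    rewrite mulr1 (le_trans ew) // lerD2l.
    have -> // : \int[mu]_(s in `[0, t]) f N s w = \int[mu]_(s in `[0, t]) eta s w.
    by apply: eq_Rintegral => s _; rewrite /f indicE wN mulr1.
  have [_ /le_trans] := ae_le_Rintegral (measurable_section (mf N) t0) ig (f0 N t) le_fg.
  apply; rewrite RintegralD // ?RintegralZl // ?e ?lerD2r ?hbH //.
  exact: ihb.
have SC N : (\int[P]_(w in Om N) S w <= Cst%:E)%E.
  have [i1 _ _] := integrable_process_fubini (if_ N).
  have := fC N; rewrite -lee_fin; apply: le_trans.
  rewrite [X in (_ <= X%:E)%E]/Rintegral fineK ?integrable_fin_num // [leLHS]integral_mkcond.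
  apply: ge0_le_integral => //.
  - by move=> w _; rewrite patchE; case: ifP.
  - by apply: (measurable_restrictT _ (mOm N)).1; exact: measurable_funTS.
  - by case/integrableP: i1.
  move=> w _ /=.
  have -> : (\int[mu]_(t in `[0, h]) f N t w) = fine ((S \_ (Om N)) w).
    rewrite /Rintegral; congr fine; rewrite -fS integral_mkcond.
    apply: eq_integral => t _; rewrite patchE /windowed /= indicE.
    by case: (t \in _); rewrite ?mulr1 ?mulr0 ?normr0 // ger0_norm.
  rewrite patchE; case: ifPn => [/set_mem wN|_] //.
  by rewrite fineK // ge0_fin_numE // (le_lt_trans wN) ?ltry.
(* Monotone convergence along [Om N], whose union has full measure because almost every path is
   integrable. *)
have bigS : (\int[P]_w S w <= Cst%:E)%E.
  have <- : (\int[P]_(w in \bigcup_N Om N) S w = \int[P]_w S w)%E.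
    have mU : measurable (\bigcup_N Om N) by exact: bigcup_measurable.
    rewrite integral_mkcond; apply: ae_eq_integral => //.
      by apply: (measurable_restrictT _ mU).1; exact: measurable_funTS.
    apply: filterS paths => w iw _; rewrite patchE mem_set //.
    have Soo : (S w < +oo)%E.
      rewrite (_ : S w = \int[mu]_(t in `[0%R, h]) `|(eta t w)%:E|)%E.
        by have /integrableP[_] := iw.
      rewrite [RHS]integral_mkcond; apply: eq_integral => t _.
      rewrite patchE /windowed /= indicE ger0_norm //.
      by case: (t \in _); rewrite ?mulr1 ?mulr0.
    exists (Num.truncn (fine (S w))).+1 => //=; rewrite /Om /=.
    rewrite -[S w]fineK ?ge0_fin_numE // lee_fin.
    by rewrite ltW // truncnS_gt.
  have ndOm : nondecreasing_seq Om.
    move=> M N MN; apply/subsetPset => w /= /le_trans; apply.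
    by rewrite lee_fin ler_nat.
  have cv := @ge0_nondecreasing_set_cvg_integral _ _ _ Om S P ndOm mOm
    (fun N => measurable_funTS mS) (fun N w _ => S0 w).
  rewrite -(cvg_lim _ cv) //; apply: lime_le; first by apply/cvg_ex; eexists; exact: cv.
  exact: nearW.
apply: integrable_processP => //.
apply: le_lt_trans (ltry Cst); apply: le_trans bigS.
rewrite le_eqVlt; apply/orP; left; apply/eqP.
apply: eq_integral => w _; apply: eq_integral => t _.
by rewrite ger0_norm.
Qed.

End GronwallProcess.

Section MeanDynamics.
Context {R : realType} {d : measure_display} {T : measurableType d}.
Variable P : probability T R.
Notation mu := (@lebesgue_measure R).

Lemma ae_eq_integrable (f g : T -> R) : measurable_fun setT f ->
  P.-integrable setT (EFin \o g) -> {ae P, forall w, f w = g w} ->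
  P.-integrable setT (EFin \o f).
Proof.
move=> mf ig fg.
have mn : measurable_fun setT (fun w => `|f w|) by exact: measurableT_comp.
have [] := @ae_le_Rintegral _ _ _ P (fun w => `|f w|) (fun w => `|g w|) mn.
- by have := integrable_norm ig.
- by [].
- by apply: filterS fg => w ->.
move=> i _; apply: (le_integrable measurableT _ _ i).
  exact/measurable_EFinP.
by move=> w _ /=; rewrite lee_fin normr_id.
Qed.

(** Almost surely W t is its increment from time 0, normal with standard deviation sqrt t; t = 0 is
    separate because the law is specified only for increments between distinct times. *)
Lemma brownian_moments (p : nat) (W : R -> T -> 'cV[R]_p) (t : R) (k : 'I_p) :
  brownian_motion P W -> 0 <= t ->
  [/\ P.-integrable setT (EFin \o (fun w => W t w k 0)),
      \int[P]_w `|W t w k 0| <= Num.sqrt 2 * Num.sqrt t &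
      \int[P]_w W t w k 0 = 0].
Proof.
move=> bm t0.
have mW r : 0 <= r -> measurable_fun setT (fun w => W r w k 0).
  by move=> r0; exact: (bm_random bm r0 k).
pose D w := W t w k 0 - W 0 w k 0.
have mD : measurable_fun setT D by apply: measurable_funB; exact: mW.
have DW : {ae P, forall w, W t w k 0 = D w}.
  by apply: filterS (bm_start bm) => w W0; rewrite /D W0 mxE subr0.
have mN (f : T -> R) : measurable_fun setT f -> measurable_fun setT (fun w => `|f w|).
  by move=> mf; exact: measurableT_comp.
have DWN : {ae P, forall w, `|W t w k 0| = `|D w|}.
  by apply: filterS DW => w ->.
have [iD nD eD] : [/\ P.-integrable setT (EFin \o D),
    \int[P]_w `|D w| <= Num.sqrt 2 * Num.sqrt t & \int[P]_w D w = 0].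
  move: t0; rewrite le_eqVlt => /predU1P[t0|t0].
    have D0 : D = cst 0 by apply/funext => w; rewrite /D -t0 subrr.
    rewrite D0 -t0 sqrtr0 mulr0; split.
    - exact: integrable0.
    - by under eq_Rintegral do rewrite normr0; rewrite Rintegral_cst ?mul0r.
    - by rewrite Rintegral_cst ?mul0r.
  have st : 0 < Num.sqrt t by rewrite sqrtr_gt0.
  have [|i1 i2 i3] := normal_moments (P := P) st mD.
    by move=> U mU; have := bm_gaussian bm k (lexx 0) t0 mU; rewrite subr0.
  split=> //; rewrite -lee_fin /Rintegral fineK //.
  by apply: integrable_fin_num => //; have := integrable_norm i1.
split.
- exact: ae_eq_integrable (mW t t0) iD DW.
- by rewrite (ae_eq_Rintegral (mN _ (mW t t0)) (mN _ mD) DWN).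
- by rewrite (ae_eq_Rintegral (mW t t0) mD DW).
Qed.

Lemma random_vector_integrable (n : nat) (x0 : T -> 'cV[R]_n) (i : 'I_n) :
  random_vector x0 -> (\int[P]_w (normsq (x0 w))%:E < +oo)%E ->
  P.-integrable setT (EFin \o (fun w => x0 w i 0)).
Proof.
move=> mx0 fx0.
have iN : P.-integrable setT (EFin \o (fun w => normsq (x0 w))).
  apply/integrableP; split.
    apply/measurable_EFinP; apply: measurable_sum => j.
    by apply: measurable_funX; exact: mx0.
  under eq_integral.
    move=> w _ /=; rewrite ger0_norm; last by apply: sumr_ge0 => j _; exact: sqr_ge0.
    over.
  by [].
have i1 : P.-integrable setT (EFin \o (cst 1 : T -> R)).
  by apply: finite_measure_integrable_cst.
apply: (le_integrable measurableT _ _ (integrableD measurableT i1 iN)).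
  by apply/measurable_EFinP; exact: mx0.
move=> w _ /=; rewrite lee_fin.
have nx : x0 w i 0 ^+ 2 <= normsq (x0 w).
  by rewrite /normsq (bigD1 i) //= lerDl sumr_ge0 // => j _; exact: sqr_ge0.
apply: le_trans (ler_norm _).
have := sqr_ge0 (`|x0 w i 0| - 1); have := sqr_ge0 (`|x0 w i 0|).
move: nx; rewrite -(real_normK (num_real (x0 w i 0))); nra.
Qed.

Lemma integrable_process_norm h Z :
  integrable_process P h Z -> integrable_process P h (fun t w => `|Z t w|).
Proof.
move=> /integrable_norm; congr (_.-integrable _ _).
apply/funext => -[t w] /=; rewrite /windowed /= normrM indicE.
by congr (_ * _)%:E; rewrite ger0_norm.
Qed.

Lemma mxint_affine (n m q : nat) (A : 'M[R]_(q, n)) (B : 'M[R]_(q, m))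
    (x : R -> 'cV[R]_n) (u : R -> 'cV[R]_m) (a b : R) :
  (forall i, mu.-integrable `[a, b] (EFin \o (fun t => x t i 0))) ->
  (forall i, mu.-integrable `[a, b] (EFin \o (fun t => u t i 0))) ->
  (forall i, mu.-integrable `[a, b] (EFin \o (fun t => (A *m x t + B *m u t) i 0))) /\
  mxint a b (fun t => A *m x t + B *m u t) = A *m mxint a b x + B *m mxint a b u.
Proof.
move=> ix iu.
have mab : measurable (`[a, b]%classic : set (measurableTypeR R)) by exact: measurable_itv.
have E t i : (A *m x t + B *m u t) i 0 =
    \sum_k A i k * x t k 0 + \sum_k B i k * u t k 0 by rewrite !mxE.
have lx i := @Rintegral_lincomb _ _ (measurableTypeR R) mu _ _ (A i) _ mab ix.
have lu i := @Rintegral_lincomb _ _ (measurableTypeR R) mu _ _ (B i) _ mab iu.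
split=> [i|].
  have := integrableD mab (lx i).1 (lu i).1.
  by apply: eq_integrable => // t _ /=; rewrite E.
apply/matrixP => i j; rewrite (ord1 j) mxE.
transitivity (\int[mu]_(t in `[a, b])
   (\sum_k A i k * x t k 0 + \sum_k B i k * u t k 0)).
  by apply: eq_Rintegral => t _; rewrite E.
rewrite RintegralD //; [|exact: (lx i).1|exact: (lu i).1].
rewrite (lx i).2 (lu i).2 !mxE.
by congr (_ + _); apply: eq_bigr => k _; rewrite mxE.
Qed.

End MeanDynamics.

(** * Integrability of the state and the equation of its mean *)

Section StateMean.
Context {R : realType} {d : measure_display} {T : measurableType d}.
Variable P : probability T R.
Notation mu := (@lebesgue_measure R).

(** The l1 norm is chosen because its bounds are finite linear combinations of coordinates, to which
    [Rintegral_lincomb] applies. *)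
Definition norm1 (n : nat) (v : 'cV[R]_n) : R := \sum_i `|v i 0|.

Lemma norm1_ge0 (n : nat) (v : 'cV[R]_n) : 0 <= norm1 v.
Proof. by apply: sumr_ge0. Qed.

Lemma norm1D (n : nat) (v w : 'cV[R]_n) : norm1 (v + w) <= norm1 v + norm1 w.
Proof.
rewrite /norm1 -big_split /=; apply: ler_sum => i _.
by rewrite mxE ler_normD.
Qed.

Lemma norm1M (n m : nat) (M : 'M[R]_(n, m)) (v : 'cV[R]_m) :
  norm1 (M *m v) <= \sum_k norm1 (col k M) * `|v k 0|.
Proof.
apply: (@le_trans _ _ (\sum_i \sum_k `|M i k| * `|v k 0|)).
  apply: ler_sum => i _; rewrite mxE; apply: (le_trans (ler_norm_sum _ _ _)).
  by apply: ler_sum => k _; rewrite normrM.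
rewrite exchange_big /=; apply: ler_sum => k _.
by rewrite /norm1 mulr_suml; apply: ler_sum => i _; rewrite mxE.
Qed.

Lemma norm_mxint (n : nat) (x : R -> 'cV[R]_n) (a b : R) i :
  mu.-integrable `[a, b] (EFin \o (fun t => x t i 0)) ->
  `|mxint a b x i 0| <= \int[mu]_(t in `[a, b]) `|x t i 0|.
Proof.
by move=> ix; rewrite mxE; apply: (@le_normr_Rintegral _ (measurableTypeR R)).
Qed.

Variables (n m p : nat) (rho : R).
Variables (A : 'M[R]_n) (B : 'M[R]_(n, m)) (C : 'M[R]_(n, p)).
Variables (W : R -> T -> 'cV[R]_p) (x0 : T -> 'cV[R]_n).
Variables (u : R -> T -> 'cV[R]_m) (x : R -> T -> 'cV[R]_n).
Hypothesis rho0 : 0 < rho.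
Hypothesis bm : brownian_motion P W.
Hypothesis mx0 : random_vector x0.
Hypothesis fx0 : (\int[P]_w (normsq (x0 w))%:E < +oo)%E.
Hypothesis adm : admissible P rho W u.
Hypothesis sde : linear_sde_solution P A B C W u x0 x.

Let iu h l : 0 <= h -> integrable_process P h (fun t w => u t w l 0).
Proof. by move=> h0; exact: control_integrable (ltW rho0) h0 adm. Qed.

Lemma state_paths_integrable (h : R) :
  {ae P, forall w, forall i, mu.-integrable `[0, h] (EFin \o (fun t => x t w i 0))}.
Proof.
apply: filterS (sde_continuous sde) => w cw i.
apply: continuous_compact_integrable; first exact: segment_compact.
apply: continuous_subspaceW (cw i) => t /=; rewrite !in_itv /= andbT.
by case/andP.
Qed.

Lemma control_paths_integrable (h : R) : 0 <= h ->
  {ae P, forall w, forall l, mu.-integrable `[0, h] (EFin \o (fun t => u t w l 0))}.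
Proof.
move=> h0; apply: filter_forall => l.
exact: integrable_process_paths (iu l h0).
Qed.

(** Splitting the integral of A x + B u needs integrable paths, available almost surely on [[0, h]];
    the exceptional null set is the same for all [t <= h]. *)
Lemma state_equation (h : R) : 0 <= h ->
  {ae P, forall w, forall t, 0 <= t <= h ->
    x t w = x0 w + (A *m mxint 0 t (x^~ w) + B *m mxint 0 t (u^~ w)) + C *m W t w}.
Proof.
move=> h0.
apply: filterS3 (sde_equation sde) (state_paths_integrable h) (control_paths_integrable h0).
move=> w ew ixw iuw t /andP[t0 th]; rewrite ew //.
have [|i|_ ->] := @mxint_affine R _ _ _ A B (x^~ w) (u^~ w) 0 t _ _ => //.
  by move=> i; exact: integrable_subitv (lexx 0) th (ixw i).
exact: integrable_subitv (lexx 0) th (iuw i).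
Qed.

Lemma state_integrable (h : R) (i : 'I_n) : 0 <= h ->
  integrable_process P h (fun t w => x t w i 0).
Proof.
move=> h0.
pose U l w := \int[mu]_(s in `[0, h]) `|u s w l 0|.
have iU l : P.-integrable setT (EFin \o U l).
  by have [] := integrable_process_fubini (integrable_process_norm (iu l h0)).
have U0 l w : 0 <= U l w by apply: Rintegral_ge0.
pose eta t w := norm1 (x t w).
(* Bounds for the terms not involving [A]. [U] integrates over all of [[0, h]] to be uniform in [t],
   and the factors 1 fit the shape of [Rintegral_lincomb]. *)
pose hb t w := \sum_j 1 * `|x0 w j 0| + \sum_l norm1 (col l B) * U l w
               + \sum_k norm1 (col k C) * `|W t w k 0|.
pose a := \sum_k norm1 (col k A).
(* The Brownian bound sqrt 2 sqrt t is replaced by its value at t = h. *)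
pose H := \sum_j 1 * \int[P]_w `|x0 w j 0| + \sum_l norm1 (col l B) * \int[P]_w U l w
          + \sum_k norm1 (col k C) * (Num.sqrt 2 * Num.sqrt h).
have mx j : jointly_measurable (fun t w => x t w j 0) by exact: (sde_measurable sde j).
have meta : jointly_measurable eta.
  by apply: measurable_sum => j; apply: measurableT_comp => //; exact: mx.
have lx0 := Rintegral_lincomb (fun=> 1) measurableT
  (fun j : 'I_n => integrable_norm (random_vector_integrable j mx0 fx0)).
have lU := Rintegral_lincomb (fun l => norm1 (col l B)) measurableT iU.
have iW t (t0 : 0 <= t) (k : 'I_p) : P.-integrable setT (EFin \o (fun w => `|W t w k 0|)).
  by have [iWk _ _] := brownian_moments k bm t0; exact: (integrable_norm iWk).
have lW t (t0 : 0 <= t) := Rintegral_lincomb (fun k => norm1 (col k C)) measurableT (iW t t0).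
have ihb t : 0 <= t <= h -> P.-integrable setT (EFin \o hb t).
  case/andP => t0 _.
  exact: (integrableD measurableT (integrableD measurableT lx0.1 lU.1) (lW t t0).1).
have hbH t : 0 <= t <= h -> \int[P]_w hb t w <= H.
  case/andP => t0 th.
  rewrite RintegralD //; [|exact: integrableD lx0.1 lU.1|exact: (lW t t0).1].
  rewrite RintegralD //; [|exact: lx0.1|exact: lU.1].
  rewrite [X in X + _ + _]lx0.2 lU.2 (lW t t0).2 lerD2l; apply: ler_sum => k _.
  apply: ler_wpM2l; first exact: norm1_ge0.
  have [_ + _] := brownian_moments k bm t0; move=> /le_trans; apply.
  by apply: ler_wpM2l; rewrite ?sqrtr_ge0 // ler_wsqrtr.
have hb0 t w : 0 <= hb t w.
  rewrite /hb !addr_ge0 //; apply: sumr_ge0 => k _.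
  - by rewrite mul1r.
  - by rewrite mulr_ge0 // norm1_ge0.
  - by rewrite mulr_ge0 // norm1_ge0.
have pe : {ae P, forall w, mu.-integrable `[0, h] (EFin \o eta^~ w)}.
  apply: filterS (state_paths_integrable h) => w ixw.
  have mh : measurable (`[0, h]%classic : set (measurableTypeR R)) by exact: measurable_itv.
  have [+ _] := @Rintegral_lincomb _ _ (measurableTypeR R) mu _ _ (fun=> 1) _ mh
    (fun j => integrable_norm (ixw j)).
  apply: eq_integrable => // t _ /=; congr EFin.
  by apply: eq_bigr => j _; rewrite mul1r.
have ie : integrable_process P h eta.
  apply: (@gronwall_process _ _ _ P h a H eta hb) => //.
  - by apply: sumr_ge0 => k _; exact: norm1_ge0.
  - apply: le_trans (hbH 0 _); last by rewrite lexx.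
    by apply: Rintegral_ge0 => w _; exact: hb0.
  - by move=> t w; exact: norm1_ge0.
  apply: filterS3 (state_equation h0) (filterI pe (state_paths_integrable h))
    (control_paths_integrable h0) => w ew [ieta ixw] iuw t th.
  have /andP[t0 t1] := th.
  have ixt k := integrable_subitv (lexx 0) t1 (ixw k).
  have iut k := integrable_subitv (lexx 0) t1 (iuw k).
  have mt : measurable (`[0, t]%classic : set (measurableTypeR R)) by exact: measurable_itv.
  rewrite {1}/eta ew //; apply: (le_trans (norm1D _ _)).
  have := norm1D (x0 w) (A *m mxint 0 t (x^~ w) + B *m mxint 0 t (u^~ w)).
  have := norm1D (A *m mxint 0 t (x^~ w)) (B *m mxint 0 t (u^~ w)).
  have := norm1M C (W t w).
  have Ale : norm1 (A *m mxint 0 t (x^~ w)) <= a * \int[mu]_(s in `[0, t]) eta s w.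
    apply: (le_trans (norm1M _ _)); rewrite /a mulr_suml; apply: ler_sum => k _.
    apply: ler_wpM2l; first exact: norm1_ge0.
    apply: (le_trans (norm_mxint (ixt k))).
    apply: (@le_Rintegral _ (measurableTypeR R)) => //.
    - exact: (integrable_norm (ixt k)).
    - exact: (integrable_subitv (lexx 0) t1 ieta).
    move=> s _; rewrite /eta /norm1 (bigD1 k) //= lerDl.
    exact: sumr_ge0.
  have Ble : norm1 (B *m mxint 0 t (u^~ w)) <= \sum_l norm1 (col l B) * U l w.
    apply: (le_trans (norm1M _ _)); apply: ler_sum => k _.
    apply: ler_wpM2l; first exact: norm1_ge0.
    apply: (le_trans (norm_mxint (iut k))).
    have iun := integrable_norm (iuw k); have iutn := integrable_norm (iut k).
    apply: fine_le; rewrite ?integrable_fin_num //.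
    apply: (@ge0_subset_integral _ (measurableTypeR R)) => //.
    - by case/integrableP: iun.
    - move=> s /=; rewrite !in_itv /= => /andP[-> st].
      exact: le_trans st t1.
  have -> : norm1 (x0 w) = \sum_j 1 * `|x0 w j 0|.
    by apply: eq_bigr => j _; rewrite mul1r.
  rewrite /hb; move: Ale Ble.
  lra.
apply: (le_integrable measurableT _ _ ie).
  by apply/measurable_EFinP; exact: measurable_windowed.
move=> [t w] _ /=; rewrite lee_fin /windowed /= !normrM ler_wpM2r //.
rewrite [leRHS]ger0_norm ?norm1_ge0 // /eta /norm1 (bigD1 i) //= lerDl.
exact: sumr_ge0.
Qed.

Lemma meanE (q : nat) (Z : T -> 'cV[R]_q) i : mean P Z i 0 = \int[P]_w Z w i 0.
Proof. by rewrite mxE unlock. Qed.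

Lemma mean_equation (t : R) : 0 <= t ->
  mean P (x t) = mean P x0
    + (A *m mxint 0 t (fun s => mean P (x s)) + B *m mxint 0 t (fun s => mean P (u s))).
Proof.
move=> t0; apply/matrixP => i j; rewrite (ord1 j) meanE.
have fx k := integrable_process_fubini (state_integrable k t0).
have fu l := integrable_process_fubini (iu l t0).
have ix k : P.-integrable setT (EFin \o (fun w => mxint 0 t (x^~ w) k 0)).
  by have [+ _ _] := fx k; apply: eq_integrable => // w _; rewrite /= mxE.
have iuu l : P.-integrable setT (EFin \o (fun w => mxint 0 t (u^~ w) l 0)).
  by have [+ _ _] := fu l; apply: eq_integrable => // w _; rewrite /= mxE.
have iW k : P.-integrable setT (EFin \o (fun w => W t w k 0)).
  by have [] := brownian_moments k bm t0.
have ix0 := random_vector_integrable i mx0 fx0.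
have lx := Rintegral_lincomb (A i) measurableT ix.
have lu := Rintegral_lincomb (B i) measurableT iuu.
have lW := Rintegral_lincomb (C i) measurableT iW.
pose rhs w := x0 w i 0 + (\sum_k A i k * mxint 0 t (x^~ w) k 0
  + \sum_l B i l * mxint 0 t (u^~ w) l 0) + \sum_k C i k * W t w k 0.
have ixu := integrableD measurableT lx.1 lu.1.
have i0xu := integrableD measurableT ix0 ixu.
have irhs : P.-integrable setT (EFin \o rhs) by exact: integrableD i0xu lW.1.
have mxt : measurable_fun setT (fun w => x t w i 0).
  exact: (measurable_section (Z := fun t w => x t w i 0) (sde_measurable sde i) t0).
have mrhs : measurable_fun setT rhs.
  by apply/measurable_EFinP; case/integrableP: irhs.
have -> : \int[P]_w x t w i 0 = \int[P]_w rhs w.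
  apply: ae_eq_Rintegral => //.
  apply: filterS (state_equation t0) => w -> //; last by rewrite t0 lexx.
  by rewrite /rhs !mxE.
rewrite /rhs RintegralD //; last exact: lW.1.
rewrite RintegralD //.
rewrite RintegralD //; [|exact: lx.1|exact: lu.1].
rewrite lx.2 lu.2 lW.2 [X in _ + X]big1 ?addr0; last first.
  by move=> k _; have [_ _ ->] := brownian_moments k bm t0; rewrite mulr0.
rewrite [RHS]mxE meanE; congr (_ + _).
rewrite [RHS]mxE [X in _ = X + _]mxE [X in _ = _ + X]mxE.
congr (_ + _); apply: eq_bigr => k _; congr (_ * _).
- have [_ _] := fx k; rewrite mxE => e.
  under eq_Rintegral do rewrite mxE.
  by rewrite e; apply: eq_Rintegral => s _; rewrite meanE.
- have [_ _] := fu k; rewrite mxE => e.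
  under eq_Rintegral do rewrite mxE.
  by rewrite e; apply: eq_Rintegral => s _; rewrite meanE.
Qed.

Lemma mean_control_integrable (h : R) (l : 'I_m) : 0 <= h ->
  mu.-integrable `[0, h] (EFin \o (fun t => mean P (u t) l 0)).
Proof.
move=> h0; have [_ + _] := integrable_process_fubini (iu l h0).
by congr (_.-integrable _ _); apply/funext => t; rewrite /= meanE.
Qed.

Lemma mean_state_primitive (h : R) (i : 'I_n) : 0 <= h ->
  primitive_on 0 h (fun t => mean P (x t) i 0)
    (fun t => (A *m mean P (x t) + B *m mean P (u t)) i 0).
Proof.
move=> h0.
have imx t k : 0 <= t -> mu.-integrable `[0, t] (EFin \o (fun s => mean P (x s) k 0)).
  move=> t0; have [_ + _] := integrable_process_fubini (state_integrable k t0).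
  by congr (_.-integrable _ _); apply/funext => s; rewrite /= meanE.
have aff t (t0 : 0 <= t) := mxint_affine A B (fun k => imx t k t0)
  (fun l => mean_control_integrable l t0).
split; first exact: (aff h h0).1.
move=> t /andP[t0 _].
(* The mean equation at time 0, where both integrals vanish, identifies the initial value. *)
have -> : mean P (x 0) = mean P x0.
  have Z q (f : R -> 'cV[R]_q) : mxint 0 0 f = 0.
    by apply/matrixP => k l; rewrite !mxE set_itv1 Rintegral_set1.
  by rewrite mean_equation // !Z !mulmx0 !addr0.
by rewrite (mean_equation t0) -(aff t t0).2 [LHS]mxE; congr (_ + _); rewrite mxE.
Qed.

End StateMean.

Theorem theorem1 (R : realType) (n m p : nat)
  (A : 'M[R]_n) (B : 'M[R]_(n, m)) (C : 'M[R]_(n, p))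
  (Q : 'M[R]_n) (Rm : 'M[R]_m) (rho : R)
  (hQ : posdef Q) (hR : posdef Rm) (hrho : 0 < rho)
  (* target gains *)
  (Pstar Ystar : 'M[R]_n) (Kstar KYstar : 'M[R]_(m, n))
  (hPstar : posdef Pstar)
  (hPare : rho *: Pstar = Pstar *m A + A^T *m Pstar
     - Pstar *m B *m invmx Rm *m B^T *m Pstar + Q)
  (hKstar : Kstar = invmx Rm *m B^T *m Pstar)
  (hYstar : possemidef Ystar)
  (hYare : rho *: Ystar = Ystar *m A + A^T *m Ystar
     - Ystar *m B *m invmx Rm *m B^T *m Ystar)
  (hKYstar : KYstar = invmx Rm *m B^T *m Ystar)
  (hYstab : hurwitz (A - B *m KYstar - (rho / 2)%:M))
  (* the agent *)
  (disp : measure_display) (T : measurableType disp) (P : probability T R)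
  (W : R -> T -> 'cV[R]_p) (x0 : T -> 'cV[R]_n)
  (u : R -> T -> 'cV[R]_m) (x : R -> T -> 'cV[R]_n)
  (hW : brownian_motion P W)
  (hx0 : random_vector x0)
  (hx0W : independent_sigma P (sigma_vector x0)
            (sigma_process `[0, +oo[ W))
  (hx02 : (\int[P]_w (normsq (x0 w))%:E < +oo)%E)
  (hu : admissible P rho W u)
  (hx : linear_sde_solution P A B C W u x0 x)
  (* sampling times and data *)
  (s : nat -> R) (hs0 : 0 <= s 0%N) (hs : forall j, s j < s j.+1)
  (X : R -> 'cV[R]_n) (hX : X = fun t => mean P (x t))
  (V : R -> 'cV[R]_m) (hV : V = fun t => mean P (u t))
  (* hypotheses of the theorem *)
  (hA : forall z : R[i], cspectrum A z -> complex.Re z != rho)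
  (hstab : stabilizable A B)
  (dhat : nat) (hdhat : (0 < dhat)%N)
  (hrank : forall d : nat, (dhat <= d)%N ->
     \rank (row_mx (data_IX rho X s d) (data_IXV rho X V s d))
       = (m * n + (n * n.+1)./2)%N)
  (d : nat) (hd : (dhat <= d)%N)
  (* data-driven policy iteration *)
  (K KY : nat -> 'M[R]_(m, n))
  (Pk Yk : nat -> 'M[R]_n) (Lk LYk : nat -> 'M[R]_(m, n))
  (hK0 : hurwitz (A - B *m K 0%N)) (hKY0 : hurwitz (A - B *m KY 0%N))
  (hPk : forall k, pi_solve rho X V s d
     (- ((K k)^T *m Rm *m K k) - Q) (K k) (Pk k.+1) (Lk k.+1))
  (hK : forall k, K k.+1 = invmx Rm *m Lk k.+1)
  (hYk : forall k, pi_solve rho X V s d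
     (- ((KY k)^T *m Rm *m KY k)) (KY k) (Yk k.+1) (LYk k.+1))
  (hKY : forall k, KY k.+1 = invmx Rm *m LYk k.+1) :
  (K @ \oo --> Kstar) /\ (KY @ \oo --> KYstar).
Proof.
have iV h l : 0 <= h -> (@lebesgue_measure R).-integrable `[0, h] (EFin \o (fun t => V t l 0)).
  by move=> h0; rewrite hV; exact: mean_control_integrable hrho hu _ _ h0.
have pX h i : 0 <= h ->
    primitive_on 0 h (fun t => X t i 0) (fun t => (A *m X t + B *m V t) i 0).
  by move=> h0; rewrite hX hV; exact: mean_state_primitive hrho hW hx0 hx02 hu hx _ _ h0.
have s_ge0 j : 0 <= s j by elim: j => // j /le_trans; apply; exact: ltW.
have dataE j := gram_identity rho iV pX (s_ge0 j) (ltW (hs j)).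
have rankE := hrank d hd.
have possemidef0 : possemidef (0 : 'M[R]_n).
  by split=> [|v]; rewrite ?trmx0 // mulmx0 mul0mx mxE.
have [sP _] := hPstar; have [sY _] := hYstar.
split.
- rewrite hKstar.
  apply: (policy_iteration_cvg hR hrho dataE rankE (posdefW hQ) sP hPare _ hK0 hPk hK).
  (* The weight of the closed loop of [Pstar] is definite because [Q] is; with [Pstar] definite, the
     Lyapunov criterion makes this loop Hurwitz. *)
  have sG : posdef (Q + (gain B Rm Pstar)^T *m Rm *m gain B Rm Pstar).
    have [sQ pQ] := hQ; have [sK pK] := psd_congr (gain B Rm Pstar) (posdefW hR).
    split=> [|v v0]; first by rewrite [LHS]linearD /= sQ sK.
    by rewrite mulmxDr mulmxDl mxE ltr_wpDr ?pQ.
  apply: (hurwitz_posdef hPstar sG); apply: (gain_are _ _ _ hR sP).2.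
  exact: (discounted_are hR sP hPare).
- rewrite hKYstar.
  (* With weight 0 the Lyapunov criterion has no definite term to rest on; stability of the loop of
     [Ystar] is [hYstab]. *)
  apply: (policy_iteration_cvg (Q := 0) hR hrho dataE rankE possemidef0 sY _ _ hKY0 _ hKY).
  + by rewrite addr0.
  + have -> : A - (rho / 2)%:M - B *m gain B Rm Ystar = A - B *m KYstar - (rho / 2)%:M.
      by rewrite hKYstar -/(gain B Rm Ystar) addrAC.
    exact: hYstab.
  + by move=> k; have := hYk k; rewrite subr0.
Qed.
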